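(* Let $N\ge2$, $A\in M_N(\{0,1\})$, and let $({\cal H},\pi)$ be a permutative representation of ${\cal O}_A$ with phases. Then the following decomposition into cyclic representations, unique up to unitary equivalence, holds: $$({\cal H},\pi)\sim\bigoplus_{(J,c)\in[1,\ldots,N]^*_A\times U(1)}P(J;c)^{\oplus\nu_{J,c}}\oplus\bigoplus_{K\in\langle1,\ldots,N\rangle^\infty_A}P(K)^{\oplus\nu_K},$$ where $\nu_{J,c}$ and $\nu_K$ are multiplicities. Especially, if $({\cal H},\pi)$ is cyclic, then $({\cal H},\pi)$ is equivalent to either $P(J;c)$ for some $J\in\{1,\ldots,N\}^*_{A,c}$ and $c\in U(1)$, or $P(K)$ for some $K\in\{1,\ldots,N\}^\infty_A$.
   Context: ${\bf N}=\{1,2,\ldots\}$, $U(1)=\{z\in{\bf C}:|z|=1\}$. $M_N(\{0,1\})$ is the set of $N\times N$ matrices with entries in $\{0,1\}$ having no row or column identically equal to zero. For $A=(a_{ij})\in M_N(\{0,1\})$, the Cuntz-Krieger algebra ${\cal O}_A$ is the $C^*$-algebra universally generated by partial isometries $s_1,\ldots,s_N$ satisfying $s_i^*s_i=\sum_{j=1}^N a_{ij}s_js_j^*$ for $i=1,\ldots,N$ and $\sum_{i=1}^N s_is_i^*=I$. A representation is a unital $*$-representation on a complex Hilbert space; $\sim$ between representations denotes unitary equivalence. Multiplicities are cardinal numbers (possibly $0$ or infinite). A representation $({\cal H},\pi)$ of ${\cal O}_A$ is a permutative representation with phases if there are a complete orthonormal basis $\{e_n\}_{n\in\Lambda}$ of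 ${\cal H}$, subsets $\Lambda_1,\ldots,\Lambda_N$ of $\Lambda$ and $(z_{i,n},m_{i,n})\in U(1)\times\Lambda$ ($n\in\Lambda_i$) such that $\pi(s_i)e_n=z_{i,n}e_{m_{i,n}}$ if $n\in\Lambda_i$ and $\pi(s_i)e_n=0$ otherwise. $\{1,\ldots,N\}^*_{A,c}$ (the subscript $c$ is part of the notation) is the set of finite words $(j_1,\ldots,j_k)$, $k\ge1$, in $\{1,\ldots,N\}$ with $a_{j_{i-1}j_i}=1$ for $i=2,\ldots,k$ and $a_{j_kj_1}=1$; $\{1,\ldots,N\}^\infty_A$ is the set of sequences $(j_n)_{n\in{\bf N}}$ in $\{1,\ldots,N\}$ with $a_{j_{n-1}j_n}=1$ for $n\ge2$. A nonempty finite word is periodic if it is an $m$-fold concatenation of a nonempty finite word with $m\ge2$. A finite word $J=(j_1,\ldots,j_k)$ is minimal if $\sum_{l=1}^k(j'_l-j_l)N^{k-l}\ge0$ for every cyclic rotation $(j'_1,\ldots,j'_k)$ of $J$. $[1,\ldots,N]^*_A$ is the set of minimal, non periodic elements of $\{1,\ldots,N\}^*_{A,c}$. For infinite words, $J_1\sim J_2$ if $J_1=J_3\cup J_5$, $J_2=J_4\cup J_5$ (concatenations) for some (possibly empty) finite words $J_3,J_4$ and an infinite word $J_5$; $\langle1,\ldots,N\rangle^\infty_A=\{1,\ldots,N\}^\infty_A/\!\sim$, classes being identified with representatives. For $J=(j_l)_{l=1}^p$ finite and $z\in U(1)$, $({\cal H},\pi)$ is $P(J;z)$ if there is a cyclic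 unit vector $\Omega$ with $\pi(s_{j_1}\cdots s_{j_p})\Omega=z\Omega$ and $\{\pi(s_{j_l}\cdots s_{j_p})\Omega\}_{l=1}^p$ orthonormal. For $J=(j_n)_{n\in{\bf N}}$ infinite, $({\cal H},\pi)$ is $P(J)$ if there is a cyclic unit vector $\Omega$ with $\{\pi(s_{j_n}^*\cdots s_{j_1}^* )\Omega\}_{n\in{\bf N}}$ orthonormal. For admissible words these symbols also denote the corresponding unitary equivalence class.
   Formalization: In the last sentence, ''cyclic'' is taken to mean that some vector of a basis witnessing permutativity is cyclic; with an arbitrary cyclic vector the sentence is false, e.g. for P(1;1) ⊕ P(2;1) over O_2, which is cyclic but neither a P(J;c) nor a P(K). *)

(* Defs.v *)
From HB Require Import structures.
From mathcomp Require Import all_boot all_order all_algebra.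
From mathcomp Require Import sesquilinear.
From mathcomp Require Import complex.
From mathcomp Require Import boolp classical_sets reals topology normedtype.

Set Implicit Arguments.
Unset Strict Implicit.
Unset Printing Implicit Defensive.

Import Order.TTheory GRing.Theory Num.Theory.
Import numFieldNormedType.Exports.

Local Open Scope classical_set_scope.
Local Open Scope ring_scope.
Local Open Scope complex_scope.

(* Complex Hilbert spaces.  The inner product is linear in its first argument;
   positive definiteness and Hermitian symmetry are part of [{dot _ for _}]. *)
HB.mixin Record CompleteNormedModule_isHilbert (R : realType) H
    & CompleteNormedModule R[i] H := {
  hdot : {dot H for (@Num.conj R[i])};
  hdot_norm : forall u : H, `|u| ^+ 2 = hdot u u
}.

#[short(type="hilbertType")]
HB.structure Definition Hilbert (R : realType) :=
  {H of CompleteNormedModule_isHilbert R H & CompleteNormedModule R[i] H}.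

Notation "''[' u , v ]" := (hdot u v) : ring_scope.

(* Unital C*-algebras.  The norm is a field of the mixin because a structure
   that inherits from both the ring and the normed module hierarchies clashes
   with [numDomainType]. *)
HB.mixin Record Algebra_isCStar (R : realType) B & GRing.Algebra R[i] B := {
  star : B -> B;
  starD : forall x y : B, star (x + y) = star x + star y;
  starZ : forall (a : R[i]) (x : B), star (a *: x) = a^* *: star x;
  starM : forall x y : B, star (x * y) = star y * star x;
  starK : forall x : B, star (star x) = x;
  cnorm : B -> R[i];
  cnorm_triangle : forall x y : B, cnorm (x + y) <= cnorm x + cnorm y;
  cnormZ : forall (a : R[i]) (x : B), cnorm (a *: x) = `|a| * cnorm x;
  cnorm_eq0 : forall x : B, cnorm x = 0 -> x = 0;
  cnormM : forall x y : B, cnorm (x * y) <= cnorm x * cnorm y;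
  cnorm_star : forall x : B, cnorm (star x * x) = cnorm x ^+ 2;
  cnorm_complete : forall u : nat -> B,
    (forall eps : R[i], 0 < eps -> exists n0, forall m n,
       (n0 <= m)%N -> (n0 <= n)%N -> cnorm (u m - u n) < eps) ->
    exists l : B, forall eps : R[i], 0 < eps ->
      exists n0, forall n, (n0 <= n)%N -> cnorm (u n - l) < eps
}.

#[short(type="cstarAlgType")]
HB.structure Definition CStarAlgebra (R : realType) :=
  {B of Algebra_isCStar R B & GRing.Algebra R[i] B}.

Section Operators.
Variable R : realType.

Definition bounded_operator (H : hilbertType R) (T : H -> H) : Prop :=
  linear T /\ continuous T.

Definition adjoint_operators (H : hilbertType R) (T T' : H -> H) : Prop :=
  forall u v : H, '[T u, v] = '[u, T' v].

Definition orthonormal_family (H : hilbertType R) (I : Type) (e : I -> H)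
    : Prop :=
  (forall i, `|e i| = 1) /\ (forall i j, i <> j -> '[e i, e j] = 0).

Definition lin_span (H : hilbertType R) (I : Type) (e : I -> H) : set H :=
  [set v | exists (t : seq I) (a : I -> R[i]), v = \sum_(i <- t) a i *: e i].

Definition complete_orthonormal_basis (H : hilbertType R) (I : Type)
    (e : I -> H) : Prop :=
  orthonormal_family e /\ closure (lin_span e) = [set: H].

Definition star_representation (O : cstarAlgType R) (H : hilbertType R)
    (op : O -> H -> H) : Prop :=
  [/\ forall x, bounded_operator (op x),
      forall v, linear (fun x => op x v),
      forall x y v, op (x * y) v = op x (op y v),
      forall v, op 1 v = v
    & forall x, adjoint_operators (op x) (op (star x))].

Record representation (O : cstarAlgType R) := Representation {
  rep_space :> hilbertType R;
  rep_op : O -> rep_space -> rep_space;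
  rep_opP : star_representation rep_op
}.

End Operators.

Section CuntzKrieger.
Variables (R : realType) (N : nat) (A : 'M[bool]_N).

Definition nondegenerate_mx : Prop :=
  (forall i, exists j, A i j) /\ (forall j, exists i, A i j).

Definition ck_relations (O : cstarAlgType R) (s : 'I_N -> O) : Prop :=
  [/\ forall i, s i * star (s i) * s i = s i,
      forall i, star (s i) * s i =
        \sum_(j < N) (A i j)%:R *: (s j * star (s j))
    & \sum_(i < N) s i * star (s i) = 1].

(* The same relations for bounded operators [T i] with adjoints [T' i]. *)
Definition ck_family (H : hilbertType R) (T T' : 'I_N -> H -> H) : Prop :=
  [/\ forall i, [/\ bounded_operator (T i), bounded_operator (T' i)
                  & adjoint_operators (T i) (T' i)],
      forall i v, T i (T' i (T i v)) = T i v,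
      forall i v, T' i (T i v) = \sum_(j < N) (A i j)%:R *: T j (T' j v)
    & forall v, \sum_(i < N) T i (T' i v) = v].

(* [O] with generators [s] is the universal C*-algebra for the relations; this
   determines the pair [(O, s)] up to a unique isomorphism. *)
Definition is_cuntz_krieger (O : cstarAlgType R) (s : 'I_N -> O) : Prop :=
  ck_relations s /\
  forall (H : hilbertType R) (T T' : 'I_N -> H -> H), ck_family T T' ->
    exists! op : O -> H -> H,
      star_representation op /\ (forall i, op (s i) = T i).

End CuntzKrieger.

Section Representations.
Variables (R : realType) (O : cstarAlgType R).
Implicit Types pi rho : representation O.

Definition unitarily_equivalent pi rho : Prop :=
  exists U : rep_space pi -> rep_space rho,
    [/\ linear U, bijective U, forall u v, '[U u, U v] = '[u, v]
      & forall x v, U (rep_op x v) = rep_op x (U v)].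

Definition cyclic_vector pi (v : pi) : Prop :=
  closure (range (fun x : O => rep_op x v)) = [set: rep_space pi].

(* [sigma] is the Hilbert space direct sum of the [rho i], with canonical
   inclusions [V i]. *)
Definition is_direct_sum (sigma : representation O) (I : Type)
    (rho : I -> representation O) : Prop :=
  exists V : forall i, rep_space (rho i) -> rep_space sigma,
    [/\ forall i, linear (V i) /\ (forall u v, '[V i u, V i v] = '[u, v]),
        forall i x v, V i (rep_op x v) = rep_op x (V i v),
        forall i j, i <> j -> forall u v, '[V i u, V j v] = 0
      & closure (lin_span (fun p : {i & rep_space (rho i)} =>
                             V (projT1 p) (projT2 p))) = [set: rep_space sigma]].

End Representations.

(* Words; the letters 1, ..., N are represented by 0, ..., N - 1 in ['I_N]. *)
Section Words.
Variables (N : nat) (A : 'M[bool]_N).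

Definition admissible_cycle (J : seq 'I_N) : bool :=
  (J != [::]) && cycle (fun i j => A i j) J.

Definition admissible_sequence (K : nat -> 'I_N) : Prop :=
  forall n, A (K n) (K n.+1).

Definition periodic_word (J : seq 'I_N) : Prop :=
  exists (w : seq 'I_N) (m : nat),
    [/\ w != [::], (1 < m)%N & J = flatten (nseq m w)].

Definition letter (J : seq 'I_N) (l : nat) : int :=
  (nth 0%N (map val J) l)%:Z.

(* The exponent is k - l for the 1-based position of the letter. *)
Definition minimal_word (J : seq 'I_N) : Prop :=
  forall r : nat,
    0 <= \sum_(l < size J)
           (letter (rot r J) l - letter J l) * N%:Z ^+ (size J - l.+1).

Definition cycle_label : Type :=
  {J : seq 'I_N | [/\ admissible_cycle J, minimal_word J & ~ periodic_word J]}.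

Definition cat_sequence (w : seq 'I_N) (K : nat -> 'I_N) : nat -> 'I_N :=
  fun n => nth (K (n - size w)%N) w n.

Definition tail_equivalent (K L : nat -> 'I_N) : Prop :=
  exists (w w' : seq 'I_N) (M : nat -> 'I_N),
    K = cat_sequence w M /\ L = cat_sequence w' M.

Definition tail_class (K : nat -> 'I_N) : set (nat -> 'I_N) :=
  [set L | admissible_sequence L /\ tail_equivalent K L].

Definition tail_label : Type :=
  {k : set (nat -> 'I_N) | exists2 K, admissible_sequence K & k = tail_class K}.

End Words.

Definition unit_circle (R : realType) : Type := {c : R[i] | `|c| == 1}.

Section Permutative.
Variables (R : realType) (N : nat) (A : 'M[bool]_N).
Variables (O : cstarAlgType R) (s : 'I_N -> O).
Implicit Types pi rho : representation O.

Definition permutative_basis pi (Lambda : Type) (e : Lambda -> pi) : Prop :=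
  complete_orthonormal_basis e /\
  exists (D : 'I_N -> set Lambda) (z : 'I_N -> Lambda -> R[i])
         (m : 'I_N -> Lambda -> Lambda),
    forall i n,
      (D i n -> `|z i n| = 1 /\ rep_op (s i) (e n) = z i n *: e (m i n)) /\
      (~ D i n -> rep_op (s i) (e n) = 0).

Definition permutative pi : Prop :=
  exists (Lambda : Type) (e : Lambda -> pi), permutative_basis e.

(* Cyclicity of a permutative representation refers to its basis: some basis
   vector is cyclic.  Having an arbitrary cyclic vector is weaker: a direct sum
   of two inequivalent irreducible permutative representations has one. *)
Definition cyclic_permutative pi : Prop :=
  exists (Lambda : Type) (e : Lambda -> pi),
    permutative_basis e /\ exists n, cyclic_vector (e n).

Definition is_P_cycle pi (J : seq 'I_N) (z : R[i]) : Prop :=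
  exists Omega : pi,
    [/\ `|Omega| = 1, cyclic_vector Omega,
        rep_op (\prod_(j <- J) s j) Omega = z *: Omega
      & orthonormal_family (fun l : 'I_(size J) =>
          rep_op (\prod_(j <- drop l J) s j) Omega)].

(* The n-th vector is s_{K n}^* ... s_{K 0}^* Omega, so that Omega itself is
   not a member of the family. *)
Definition is_P_sequence pi (K : nat -> 'I_N) : Prop :=
  exists Omega : pi,
    [/\ `|Omega| = 1, cyclic_vector Omega
      & orthonormal_family (fun n : nat =>
          rep_op (\prod_(l < n.+1) star (s (K (n - l)%N))) Omega)].

Definition label : Type := (cycle_label A * unit_circle R + tail_label A)%type.

Definition in_class (l : label) pi : Prop :=
  match l with
  | inl (J, c) => is_P_cycle pi (sval J) (sval c)
  | inr k => exists2 K, sval k K & is_P_sequence pi K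
  end.

(* [pi] is equivalent to the direct sum over all labels [l] of [nu l] members
   [rho l t], [t : nu l], of the equivalence class attached to [l]; the
   multiplicity of [l] is the cardinality of the type [nu l]. *)
Definition decomposition pi (nu : label -> Type)
    (rho : forall l, nu l -> representation O) : Prop :=
  (forall l t, in_class l (rho l t)) /\
  exists2 sigma : representation O,
    is_direct_sum sigma (fun p : {l & nu l} => rho (projT1 p) (projT2 p))
    & unitarily_equivalent pi sigma.

End Permutative.

(* Main.v *)
Require Import Defs.
From HB Require Import structures.
From mathcomp Require Import all_boot all_order all_algebra finmap.
From mathcomp Require Import zify ring.
From mathcomp Require Import separable cyclotomic cyclic.
From mathcomp Require Import complex.
From mathcomp Require Import boolp classical_sets functions cardinality fsbigop.
From mathcomp Require Import reals ereal esum topology normedtype.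

Set Implicit Arguments.
Unset Strict Implicit.
Unset Printing Implicit Defensive.

Import Order.TTheory GRing.Theory Num.Theory.
Import numFieldNormedType.Exports.

Local Open Scope classical_set_scope.
Local Open Scope ring_scope.
Local Open Scope complex_scope.

(** Write [raise i] and [lower i] for the operators of s_i and of its adjoint.
    A vector is [coded] by a sequence K of letters when K 0, K 1, ... can be
    removed from it one after the other without loss, that is, when it lies in
    the range of every product s_(K 0) ... s_(K n); [down K n] removes the first
    n letters. As the ranges of the s_i are mutually orthogonal, vectors with
    different codes are orthogonal ([coded_ortho]).

    P(K) is generated by a unit vector with code K whose vectors [down K n v]
    are orthonormal, and P(J; c) by one whose code is the repetition of J and
    for which [down] along J is multiplication by 1 / c ([P_sequence_std],
    [P_cycle_std] and their converses). The cyclic subspace of a coded vector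
    [v] is spanned by the vectors obtained from the [down K n v] by prepending
    letters ([cyc_coded]), and their Gram matrix depends only on the inner
    products of the [down K n v] ([coded_gram]). Hence each class is a single
    unitary equivalence class, which for an infinite word depends only on the
    tail, and vectors of different classes generate orthogonal subspaces
    ([std_disjoint]): the tails of the codes differ, or two phases along the
    same cycle differ, or a vector that is periodic up to phases is paired with
    an orthonormal sequence, which Bessel forbids.

    The universal property enters through its uniqueness clause only. It shows
    that a unitary commuting with the generators commutes with the whole algebra
    ([intertwiner]); applied to the symmetry 2 P - 1 of a closed subspace stable
    under the generators and their adjoints it shows that this subspace is
    stable under the whole algebra ([reducing_invariant]).

    Existence. Every basis vector is coded, and removing its first letter gives
    a multiple of a basis vector; the basis falls into classes of vectors
    whose orbits under this map meet, and different classes generate orthogonal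
    subspaces ([cyc_basis_ortho]). A class whose orbits are infinite is one
    P(K). In the other classes the orbits end in a cycle; after rotation the
    code of a vector on it is the repetition of a minimal non periodic word J,
    but the cycle may run through J several times, say m times, and then it
    splits into m eigenvectors of [down] along J with different eigenvalues
    ([cycle_eigenvectors], [component_split]).

    Uniqueness. Fix a label and two decompositions with generating vectors
    Omega_t and Omega'_u for this label. In the closed subspace of the vectors
    with the code of the label each Omega_t contributes an orthonormal family,
    its [frame]: the vector itself for a cycle, its images under all ways of
    removing and prepending letters that restore the code for an infinite word.
    By disjointness Omega'_u lies in the closed span of the frames of all
    Omega_t, so by Parseval its squared coefficients add up to one. Let the
    entry at (t, u) be the sum of the squared coefficients of Omega'_u along the
    frame of Omega_t. The adjoint of a frame operation is the inverse one, so
    the entry stays the same when the two decompositions are exchanged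
    ([frame_weightC]), and all rows and all columns of the array add up to one.
    Such an array has as many rows as columns, whatever their cardinality
    ([doubly_stochastic_bij]). *)

(** * Complex scalars *)

Lemma conj_unit (R : realType) (c : R[i]) : `|c| = 1 -> Num.conj c = c^-1.
Proof. by move=> c1; rewrite invC_norm c1 expr1n invr1 mul1r. Qed.

Lemma unit_neq0 (R : realType) (c : R[i]) : `|c| = 1 -> c != 0.
Proof. by move=> c1; rewrite -normr_eq0 c1 oner_eq0. Qed.

(** * Inner products and closed subspaces *)

Section InnerProduct.
Variables (R : realType) (H : hilbertType R).
Implicit Types (u v w : H) (a : R[i]).

Lemma dotC u v : '[u, v] = Num.conj '[v, u].
Proof. by rewrite hermC expr0 mul1r. Qed.
Lemma dotDl u v w : '[u + v, w] = '[u, w] + '[v, w].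
Proof. exact: linearDl. Qed.
Lemma dotZl a u v : '[a *: u, v] = a * '[u, v].
Proof. exact: linearZl_LR. Qed.
Lemma dotDr u v w : '[u, v + w] = '[u, v] + '[u, w].
Proof. by rewrite dotC dotDl rmorphD /= -!dotC. Qed.
Lemma dotZr a u v : '[u, a *: v] = Num.conj a * '[u, v].
Proof. by rewrite dotC dotZl rmorphM /= -!dotC. Qed.
Lemma dot0l v : '[0, v] = 0.
Proof. by rewrite -(scale0r v) dotZl mul0r. Qed.
Lemma dot0r v : '[v, 0] = 0.
Proof. by rewrite dotC dot0l conjC0. Qed.
Lemma dotNl u v : '[- u, v] = - '[u, v].
Proof. by rewrite -scaleN1r dotZl mulN1r. Qed.
Lemma dotNr u v : '[u, - v] = - '[u, v].
Proof. by rewrite dotC dotNl rmorphN /= -dotC. Qed.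
Lemma dotBl u v w : '[u - v, w] = '[u, w] - '[v, w].
Proof. by rewrite dotDl dotNl. Qed.
Lemma dotBr u v w : '[u, v - w] = '[u, v] - '[u, w].
Proof. by rewrite dotDr dotNr. Qed.
Lemma dot_suml (I : Type) (s : seq I) (P : pred I) (F : I -> H) v :
  '[\sum_(i <- s | P i) F i, v] = \sum_(i <- s | P i) '[F i, v].
Proof.
exact: (big_morph (fun u => '[u, v]) (fun x y => dotDl x y v) (dot0l v)).
Qed.
Lemma dot_sumr (I : Type) (s : seq I) (P : pred I) (F : I -> H) v :
  '[v, \sum_(i <- s | P i) F i] = \sum_(i <- s | P i) '[v, F i].
Proof.
exact: (big_morph (fun u => '[v, u]) (dotDr v) (dot0r v)).
Qed.
Lemma dotuu u : '[u, u] = `|u| ^+ 2.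
Proof. by rewrite hdot_norm. Qed.
Lemma dot_sym0 u v : '[u, v] = 0 -> '[v, u] = 0.
Proof. by move=> h; rewrite dotC h conjC0. Qed.
Lemma dot_uu0 u : '[u, u] = 0 -> u = 0.
Proof. by rewrite dotuu => /eqP; rewrite expf_eq0 /= normr_eq0 => /eqP. Qed.

Lemma norm_sqD u v : `|u + v| ^+ 2 = `|u| ^+ 2 + '[u, v] + '[v, u] + `|v| ^+ 2.
Proof. by rewrite -!dotuu dotDl !dotDr; ring. Qed.

Lemma pythagoras u v : '[u, v] = 0 -> `|u + v| ^+ 2 = `|u| ^+ 2 + `|v| ^+ 2.
Proof. by move=> uv0; rewrite norm_sqD uv0 (dot_sym0 uv0) !addr0. Qed.

Lemma parallelogram u v :
  `|u + v| ^+ 2 + `|u - v| ^+ 2 = `|u| ^+ 2 *+ 2 + `|v| ^+ 2 *+ 2.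
Proof. by rewrite !norm_sqD normrN dotNr dotNl; ring. Qed.

(** Splitting [v] into a multiple of [u] and a vector orthogonal to [u] leaves
    Pythagoras. *)
Lemma cauchy_schwarz u v : `|'[u, v]| <= `|u| * `|v|.
Proof.
have [->|u0] := eqVneq u 0; first by rewrite dot0l !normr0 mul0r.
have nu0 : `|u| != 0 by rewrite normr_eq0.
have [c wu] : exists c, '[v - c *: u, u] = 0.
  exists ('[v, u] / `|u| ^+ 2).
  by rewrite dotBl dotZl dotuu divfK ?subrr // expf_neq0.
rewrite -[in '[_, _]](subrK (c *: u) v) dotDr (dot_sym0 wu) add0r dotZr dotuu.
rewrite normrM norm_conjC normrX normr_id expr2 mulrA mulrC ler_wpM2l //.
rewrite -(@ler_pXn2r _ 2%N) ?nnegrE ?mulr_ge0 //.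
rewrite -[in leRHS](subrK (c *: u) v) pythagoras; last by rewrite dotZr wu mulr0.
by rewrite normrZ lerDr exprn_ge0.
Qed.

Lemma dot_ext u v : (forall w, '[u, w] = '[v, w]) -> u = v.
Proof.
move=> uv; apply/eqP; rewrite -subr_eq0; apply/eqP/dot_uu0.
by rewrite dotBl uv subrr.
Qed.

Lemma closureP (M : set H) v :
  closure M v <-> forall eps : R[i], 0 < eps -> exists2 u, M u & `|v - u| < eps.
Proof.
split=> [cv eps eps0|h B].
  have [] := cv (ball v eps).
    by apply: nbhsx_ballx.
  by move=> u [Mu]; rewrite -ball_normE /= => vu; exists u.
move=> /nbhs_normP[eps /= eps0 Beps].
have [u Mu vu] := h _ eps0.
by exists u; split => //; exact: Beps.
Qed.

Definition closed_subspace (M : set H) : Prop :=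
  [/\ M 0, forall a u v, M u -> M v -> M (a *: u + v) & closure M `<=` M].

Lemma closed_subspaceD (M : set H) u v :
  closed_subspace M -> M u -> M v -> M (u + v).
Proof. by case=> _ h _ Mu Mv; rewrite -[u]scale1r; exact: h. Qed.

Lemma closed_subspaceZ (M : set H) a u :
  closed_subspace M -> M u -> M (a *: u).
Proof. by case=> M0 h _ Mu; rewrite -[_ *: _]addr0; exact: h. Qed.

Lemma closed_subspaceN (M : set H) u : closed_subspace M -> M u -> M (- u).
Proof. by move=> cM Mu; rewrite -scaleN1r; exact: closed_subspaceZ. Qed.

Lemma closed_subspaceB (M : set H) u v :
  closed_subspace M -> M u -> M v -> M (u - v).
Proof.
by move=> cM Mu Mv; apply: closed_subspaceD => //; exact: closed_subspaceN.
Qed.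

Lemma closed_subspace_sum (M : set H) (I : Type) (s : seq I) (F : I -> H) :
  closed_subspace M -> (forall i, M (F i)) -> M (\sum_(i <- s) F i).
Proof.
move=> cM MF; elim/big_ind : _ => // [|u v]; first by case: cM.
exact: closed_subspaceD.
Qed.

Lemma orthocomplement_closed v : closed_subspace [set u | '[u, v] = 0].
Proof.
split=> /= [|a u w u0 w0|u /closureP cu]; first exact: dot0l.
  by rewrite dotDl dotZl u0 w0 mulr0 addr0.
apply/eqP; rewrite -normr_eq0; apply/eqP/le_anti; rewrite normr_ge0 andbT.
apply/ler_addgt0Pl => eps eps0; rewrite addr0.
have v1 : 0 < `|v| + 1 by rewrite ltr_wpDl.
have [w /= w0 uw] := cu (eps / (`|v| + 1)) (divr_gt0 eps0 v1).
have -> : '[u, v] = '[u - w, v] by rewrite dotBl w0 subr0.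
apply: le_trans (cauchy_schwarz _ _) _.
apply: (@le_trans _ _ (`|u - w| * (`|v| + 1))).
  by rewrite ler_wpM2l // lerDl.
by rewrite -ler_pdivlMr // ltW.
Qed.

Lemma closed_subspaceI (J : Type) (M : J -> set H) :
  (forall j, closed_subspace (M j)) -> closed_subspace [set u | forall j, M j u].
Proof.
move=> cM; split=> /= [j|a u v hu hv j|u cu j].
- by case: (cM j).
- by case: (cM j) => _ h _; exact: h.
- by case: (cM j) => _ _; apply; apply: closureS cu => w; exact.
Qed.

Definition clspan (I : Type) (e : I -> H) : set H := closure (lin_span e).

Lemma clspan_closed (I : Type) (e : I -> H) : closed_subspace (clspan e).
Proof.
have spanZD a u v : lin_span e u -> lin_span e v -> lin_span e (a *: u + v).
  move=> [s [b ->]] [t [c ->]].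
  (* The coefficient of a combination is a function of the index, so a repeated
     index has to be given the sum of its coefficients. *)
  have aux (r : seq (R[i] * {classic I})) :
      lin_span e (\sum_(p <- r) p.1 *: e p.2).
    pose F (i : {classic I}) := \sum_(p <- r | `[< p.2 = i >]) p.1.
    exists (undup [seq p.2 | p <- r]), F.
    rewrite /F; under [RHS]eq_bigr do rewrite scaler_suml.
    rewrite (exchange_big_dep xpredT) //= big_seq [RHS]big_seq.
    apply: eq_bigr => p pr.
    rewrite big_mkcond (bigD1_seq p.2) ?undup_uniq //=; last first.
      by rewrite mem_undup; apply/mapP; exists p.
    rewrite asboolT // big1 ?addr0 // => i ip.
    by case: asboolP => // pi; rewrite pi eqxx in ip.
  have -> : a *: (\sum_(i <- s) b i *: e i) + \sum_(i <- t) c i *: e i =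
      \sum_(p <- [seq (a * b i, i) | i <- s] ++ [seq (c i, i) | i <- t])
        p.1 *: e p.2.
    rewrite big_cat !big_map scaler_sumr /=; congr (_ + _).
    by apply: eq_bigr => i _; rewrite scalerA.
  exact: aux.
split=> [|a u v /closureP cu /closureP cv|u].
- by apply: subset_closure; exists [::], (fun=> 0); rewrite big_nil.
- apply/closureP => eps eps0.
  have a1 : 0 < `|a| + 1 by rewrite ltr_wpDl.
  have e2 : 0 < eps / 2 by rewrite divr_gt0.
  have [u' Mu' uu'] := cu _ (divr_gt0 e2 a1).
  have [v' Mv' vv'] := cv _ e2.
  exists (a *: u' + v'); first exact: spanZD.
  rewrite opprD addrACA -scalerBr (splitr eps).
  apply: le_lt_trans (ler_normD _ _) _; apply: ler_ltD => //.
  rewrite normrZ; apply: (@le_trans _ _ ((`|a| + 1) * `|u - u'|)).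
    by rewrite ler_wpM2r // lerDl.
  by rewrite mulrC -ler_pdivlMr // ltW.
- exact: closed_closure.
Qed.

Lemma clspan_mem (I : Type) (e : I -> H) i : clspan e (e i).
Proof.
apply: subset_closure; exists [:: i], (fun=> 1).
by rewrite big_seq1 scale1r.
Qed.

Lemma clspan_min (I : Type) (e : I -> H) (M : set H) :
  closed_subspace M -> (forall i, M (e i)) -> clspan e `<=` M.
Proof.
move=> cM Me v cv; have [_ _] := cM; apply; apply: closureS cv => u.
by move=> [s [a ->]]; apply: closed_subspace_sum => // i; exact: closed_subspaceZ.
Qed.

Lemma clspan_ortho (I : Type) (e : I -> H) v :
  (forall i, '[e i, v] = 0) -> forall u, clspan e u -> '[u, v] = 0.
Proof.
move=> ev u; apply: (@clspan_min _ _ [set u | '[u, v] = 0]) => //.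
exact: orthocomplement_closed.
Qed.

Lemma clspan_ortho2 (I J : Type) (e : I -> H) (f : J -> H) :
  (forall i j, '[e i, f j] = 0) ->
  forall u v, clspan e u -> clspan f v -> '[u, v] = 0.
Proof.
move=> ef u v eu fv; apply: (clspan_ortho _ eu) => i.
by apply: dot_sym0; apply: (clspan_ortho _ fv) => j; exact: dot_sym0.
Qed.

Lemma total_ext (I : Type) (e : I -> H) u v : clspan e = [set: H] ->
  (forall i, '[e i, u] = '[e i, v]) -> u = v.
Proof.
move=> etot euv; apply/eqP; rewrite -subr_eq0; apply/eqP/dot_uu0.
apply: (clspan_ortho (e := e)) => [i|]; first by rewrite dotBr euv subrr.
by rewrite etot.
Qed.

End InnerProduct.

Lemma invS_lt (R : realType) (eps : R[i]) : 0 < eps ->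
  exists n0, forall n, (n0 <= n)%N -> n.+1%:R^-1 < eps.
Proof.
case: eps => e e' /=; rewrite ltcE /= => /andP[/eqP -> e0].
exists (Num.bound e^-1) => n le_n.
have -> : n.+1%:R^-1 = (n.+1%:R^-1 : R)%:C by rewrite fmorphV rmorph_nat.
rewrite ltcR -[ltRHS]invrK ltf_pV2 ?posrE ?invr_gt0 //.
apply: lt_le_trans (archi_boundP _) _; first by rewrite invr_ge0 ltW.
by rewrite ler_nat ltnW.
Qed.

(** * Orthogonal projections *)

Section Completeness.
Variables (R : realType) (H : hilbertType R).
Implicit Types (u v w : H) (a : R[i]).

Lemma hilbert_complete (x : nat -> H) :
  (forall eps : R[i], 0 < eps -> exists n0, forall m n,
     (n0 <= m)%N -> (n0 <= n)%N -> `|x m - x n| < eps) ->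
  exists l, forall eps : R[i], 0 < eps -> exists n0, forall n,
    (n0 <= n)%N -> `|l - x n| < eps.
Proof.
move=> xC; have : cvg (x @ \oo).
  apply/cauchy_cvgP/cauchy_ballP => eps eps0.
  have [n0 hn0] := xC _ eps0; rewrite near_simpl /=.
  exists ([set n | (n0 <= n)%N], [set n | (n0 <= n)%N]) => /=.
    by split; exists n0.
  by move=> [m n] /= [hm hn]; rewrite -ball_normE /=; exact: hn0.
move=> /cvgrPdist_lt xl; exists (lim (x @ \oo)) => eps eps0.
by have [n0 _ hn0] := xl _ eps0; exists n0.
Qed.

(** A minimizing sequence for the distance to [M] is Cauchy by the
    parallelogram identity. *)
Lemma nearest_point (M : set H) v : closed_subspace M ->
  exists2 p, M p & forall m, M m -> `|v - p| <= `|v - m|.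
Proof.
move=> cM; pose q m : R := complex.Re (`|v - m| ^+ 2).
have qE m : `|v - m| ^+ 2 = (q m)%:C.
  by rewrite RRe_real // ger0_real // exprn_ge0.
pose D := [set q m | m in M].
have D0 : has_inf D.
  split; first by exists (q 0), 0 => //; case: cM.
  by exists 0 => _ [m _ <-]; rewrite -ler0c -qE exprn_ge0.
have [x xP] : exists x : nat -> H, forall n, M (x n) /\ q (x n) < inf D + n.+1%:R^-1.
  suff /choice[x] : forall n, exists y, M y /\ q y < inf D + n.+1%:R^-1 by exists x.
  move=> n.
  have n0 : 0 < n.+1%:R^-1 :> R by rewrite invr_gt0.
  by have [_ [m Mm <-] lt_m] := inf_adherent n0 D0; exists m.
have infD m : M m -> inf D <= q m.
  by move=> Mm; apply: ge_inf; [case: D0|exists m].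
have xx m n k : (k <= m)%N -> (k <= n)%N ->
    `|x m - x n| ^+ 2 <= 4%:R * k.+1%:R^-1.
  move=> km kn; have [Mm qm] := xP m; have [Mn qn] := xP n.
  pose y : H := 2^-1 *: (x m + x n).
  have My : M y by apply: closed_subspaceZ => //; exact: closed_subspaceD.
  have par := parallelogram (v - x m) (v - x n); move: par.
  have -> : v - x m - (v - x n) = - (x m - x n) by rewrite !opprB addrC subrKA.
  have -> : v - x m + (v - x n) = 2 *: (v - y).
    rewrite scalerBr scalerA divff ?pnatr_eq0 // scale1r opprD.
    by rewrite scaler_nat mulr2n addrACA.
  rewrite normrN normrZ exprMn !qE (ger0_norm (ler0n _ _)).
  move=> /(congr1 (fun c => c - 2 ^+ 2 * (q y)%:C)).
  rewrite [X in X - _]addrC addrK => ->.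
  have -> : 4%:R * k.+1%:R^-1 = (4%:R * k.+1%:R^-1 : R)%:C.
    by rewrite rmorphM fmorphV !rmorph_nat.
  have -> : 2 ^+ 2 * (q y)%:C = (4 * q y)%:C.
    by rewrite rmorphM rmorph_nat; congr (_ * _); ring.
  rewrite -!rmorphMn -rmorphD -rmorphB lecR lerBlDl.
  have mono j : (k <= j)%N -> j.+1%:R^-1 <= k.+1%:R^-1 :> R.
    by move=> kj; rewrite lef_pV2 ?posrE // ler_nat.
  have bnd j : (k <= j)%N -> q (x j) < inf D + j.+1%:R^-1 ->
      q (x j) *+ 2 <= (q y + k.+1%:R^-1) *+ 2.
    move=> kj lt_j; rewrite lerMn2r; apply/orP; right; apply: le_trans (ltW lt_j) _.
    by apply: lerD; [exact: infD|exact: mono].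
  apply: le_trans (lerD (bnd _ km qm) (bnd _ kn qn)) _.
  by rewrite le_eqVlt; apply/orP; left; apply/eqP; ring.
have sq_lt (a b : R[i]) : 0 <= a -> 0 <= b -> a ^+ 2 < b ^+ 2 -> a < b.
  by move=> a0 b0; rewrite ltr_pXn2r ?nnegrE.
have [|p xp] := @hilbert_complete x.
  move=> eps eps0; have [n0 hn0] := invS_lt (divr_gt0 (exprn_gt0 2 eps0) (ltr0Sn _ 3)).
  exists n0 => m n hm hn; apply: sq_lt => //; first exact: ltW.
  apply: le_lt_trans (xx _ _ _ hm hn) _.
  by rewrite mulrC -ltr_pdivlMr ?ltr0n // hn0.
have Mp : M p.
  case: cM => _ _; apply; apply/closureP => eps eps0.
  by have [n0 hn0] := xp _ eps0; exists (x n0); [case: (xP n0)|exact: hn0].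
exists p => // m Mm; apply/ler_addgt0Pl => eps eps0.
have e2 : 0 < eps / 2 by rewrite divr_gt0.
have [n1 hn1] := xp _ e2.
have [n2 hn2] := invS_lt (exprn_gt0 2 e2).
pose n := maxn n1 n2.
have {hn1}h1 : `|p - x n| < eps / 2 by apply: hn1; rewrite leq_maxl.
have {hn2}h2 : n.+1%:R^-1 < (eps / 2) ^+ 2 by apply: hn2; rewrite leq_maxr.
rewrite -(subrKA (x n)); apply: le_trans (ler_normD _ _) _.
rewrite [eps]splitr -addrA [leRHS]addrC.
apply: lerD; last by rewrite distrC ltW.
rewrite ltW //; apply: sq_lt => //; first by rewrite addr_ge0 // ltW.
rewrite qE; have [_] := xP n; rewrite -ltcR => /lt_le_trans; apply.
rewrite rmorphD fmorphV rmorph_nat.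
apply: (@le_trans _ _ (`|v - m| ^+ 2 + (eps / 2) ^+ 2)).
  by rewrite lerD ?(ltW h2) // qE lecR infD.
rewrite -subr_ge0.
have -> : (eps / 2 + `|v - m|) ^+ 2 - (`|v - m| ^+ 2 + (eps / 2) ^+ 2) =
    (eps / 2) * `|v - m| *+ 2 by ring.
by rewrite mulrn_wge0 // mulr_ge0 // ltW.
Qed.

Lemma orthogonal_projection (M : set H) v : closed_subspace M ->
  exists2 p, M p & forall m, M m -> '[v - p, m] = 0.
Proof.
move=> cM; have [p Mp minp] := nearest_point v cM.
exists p => // m Mm.
have [->|m0] := eqVneq m 0; first exact: dot0r.
have nm0 : `|m| != 0 by rewrite normr_eq0.
pose t := '[v - p, m] / `|m| ^+ 2.
have wm : '[v - p - t *: m, m] = 0.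
  by rewrite dotBl dotZl dotuu divfK ?subrr // expf_neq0.
have := minp _ (closed_subspaceD cM Mp (closed_subspaceZ t cM Mm)).
rewrite opprD addrA -(@ler_pXn2r _ 2%N) ?nnegrE // -[in leLHS](subrK (t *: m) (v - p)).
rewrite pythagoras; last by rewrite dotZr wm mulr0.
rewrite gerDl => le0; have : `|t *: m| ^+ 2 == 0.
  by rewrite eq_le le0 exprn_ge0.
rewrite expf_eq0 /= normr_eq0 scaler_eq0 (negbTE m0) orbF /t mulf_eq0.
by rewrite invr_eq0 expf_eq0 (negbTE nm0) /= orbF => /eqP.
Qed.

End Completeness.

(** * Unitaries from Gram matrices *)

Section Unitary.
Variables (R : realType).

(** Polarization: the real part of the inner product is read off from norms,
    and multiplying one vector by i gives the imaginary part. *)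
Lemma isometry_dot (H H' : hilbertType R) (U : H -> H') :
  linear U -> (forall u, `|U u| = `|u|) -> forall u v, '[U u, U v] = '[u, v].
Proof.
move=> linU nU.
have key u v : '[U u, U v] + '[U v, U u] = '[u, v] + '[v, u].
  have := norm_sqD (U u) (U v); have -> : U u + U v = U (u + v).
    by rewrite -[in RHS](scale1r u) linU scale1r.
  by rewrite !nU norm_sqD => /addIr; rewrite -!addrA => /addrI.
move=> u v; have UZ a w : U (a *: w) = a *: U w.
  have U0 : U 0 = 0 by have := linU (-1) 0 0; rewrite scaler0 addr0 scaleN1r addNr.
  by have := linU a w 0; rewrite U0 !addr0.
have := key ('i *: u) v; rewrite !UZ !dotZl !dotZr conjCi !mulNr -!mulrBr.
move=> /(mulfI (neq0Ci _)) h2; have h1 := key u v.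
have : '[U u, U v] *+ 2 = '[u, v] *+ 2.
  have -> : '[U u, U v] *+ 2 =
      ('[U u, U v] + '[U v, U u]) + ('[U u, U v] - '[U v, U u]) by ring.
  by rewrite h1 h2; ring.
by move=> /eqP; rewrite eqr_pMn2r // => /eqP.
Qed.

(** The correspondence of finite combinations is isometric, so it carries Cauchy
    sequences to Cauchy sequences and extends to the closures of the spans. *)
Lemma gram_unitary (H H' : hilbertType R) (I : Type) (b : I -> H) (b' : I -> H') :
  clspan b = [set: H] -> clspan b' = [set: H'] ->
  (forall i j, '[b i, b j] = '[b' i, b' j]) ->
  exists U : H -> H', [/\ linear U, bijective U,
    forall u v, '[U u, U v] = '[u, v] & forall i, U (b i) = b' i].
Proof.
have half (K K' : hilbertType R) (c : I -> K) (c' : I -> K') : clspan c = [set: K] ->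
    (forall i j, '[c i, c j] = '[c' i, c' j]) ->
    forall v, exists v', `|v'| = `|v| /\ forall i, '[c' i, v'] = '[c i, v].
  move=> ctot gram v.
  have dots s t (a d : I -> R[i]) :
      '[\sum_(i <- s) a i *: c i, \sum_(i <- t) d i *: c i]
    = '[\sum_(i <- s) a i *: c' i, \sum_(i <- t) d i *: c' i].
    rewrite !dot_suml; apply: eq_bigr => i _; rewrite !dot_sumr.
    by apply: eq_bigr => j _; rewrite !dotZl !dotZr gram.
  have norms s t (a d : I -> R[i]) :
      `|\sum_(i <- s) a i *: c i - \sum_(i <- t) d i *: c i|
    = `|\sum_(i <- s) a i *: c' i - \sum_(i <- t) d i *: c' i|.
    apply/eqP; rewrite -(@eqrXn2 _ 2%N) // -!dotuu.
    by rewrite !dotBl !dotBr !dots.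
  have [x xP] : exists x : nat -> seq I * (I -> R[i]), forall n,
      `|v - \sum_(i <- (x n).1) (x n).2 i *: c i| < n.+1%:R^-1.
    suff /choice[x] : forall n, exists y : seq I * (I -> R[i]),
        `|v - \sum_(i <- y.1) y.2 i *: c i| < n.+1%:R^-1 by exists x.
    move=> n.
    have /closureP/(_ n.+1%:R^-1) : clspan c v by rewrite ctot.
    rewrite invr_gt0 => /(_ (ltr0Sn _ _)) [_ [s [a ->]] lt_n].
    by exists (s, a).
  pose y n := \sum_(i <- (x n).1) (x n).2 i *: c i.
  pose y' n := \sum_(i <- (x n).1) (x n).2 i *: c' i.
  have yv eps : 0 < eps -> exists n0, forall n, (n0 <= n)%N -> `|v - y n| < eps.
    move=> /invS_lt[n0 hn0]; exists n0 => n /hn0; apply: lt_trans.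
    exact: xP.
  have [|v' yv'] := @hilbert_complete _ _ y'.
    move=> eps eps0; have [n0 hn0] := yv _ (divr_gt0 eps0 (ltr0Sn _ 1)).
    exists n0 => m n hm hn; rewrite /y' -norms -/(y m) -/(y n).
    rewrite -(subrKA v) (splitr eps).
    apply: le_lt_trans (ler_normD _ _) _; apply: ltrD; last exact: hn0.
    by rewrite distrC hn0.
  have both eps : 0 < eps -> exists n, `|v - y n| < eps /\ `|v' - y' n| < eps.
    move=> eps0; have [n1 h1] := yv _ eps0; have [n2 h2] := yv' _ eps0.
    by exists (maxn n1 n2); rewrite h1 ?h2 ?leq_maxl ?leq_maxr.
  have ny n : `|y' n| = `|y n|.
    have := norms (x n).1 [::] (x n).2 (fun=> 0).
    by rewrite !big_nil !subr0.
  have close (K1 : hilbertType R) (u w : K1) e : `|u - w| < e ->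
      `|u| <= `|w| + e /\ `|w| <= `|u| + e.
    move=> lt_e; split.
      rewrite -[u in leLHS](subrK w) addrC; apply: le_trans (ler_normD _ _) _.
      by rewrite lerD2l ltW.
    rewrite -[w in leLHS](subrK u) addrC; apply: le_trans (ler_normD _ _) _.
    by rewrite lerD2l distrC ltW.
  exists v'; split.
    apply/le_anti/andP; split; apply/ler_addgt0Pr => eps eps0.
      have [n [h1 h2]] := both _ (divr_gt0 eps0 (ltr0Sn _ 1)).
      have [_ l1] := close _ _ _ _ h1; have [l2 _] := close _ _ _ _ h2.
      rewrite (splitr eps) addrA; apply: le_trans l2 _.
      by rewrite lerD2r ny.
    have [n [h1 h2]] := both _ (divr_gt0 eps0 (ltr0Sn _ 1)).
    have [l1 _] := close _ _ _ _ h1; have [_ l2] := close _ _ _ _ h2.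
    rewrite (splitr eps) addrA; apply: le_trans l1 _.
    by rewrite lerD2r -ny.
  move=> i; apply/eqP; rewrite -subr_eq0 -normr_eq0; apply/eqP/le_anti.
  rewrite normr_ge0 andbT; apply/ler_addgt0Pl => eps eps0; rewrite addr0.
  have k0 : 0 < `|c i| + `|c' i| + 1 by rewrite ltr_wpDl // addr_ge0.
  have [n [h1 h2]] := both _ (divr_gt0 eps0 k0).
  have dy : '[c' i, y' n] = '[c i, y n].
    have := dots [:: i] (x n).1 (fun=> 1) (x n).2.
    by rewrite !big_seq1 !scale1r.
  have -> : '[c' i, v'] - '[c i, v] = '[c' i, v' - y' n] - '[c i, v - y n].
    by rewrite !dotBr dy; ring.
  apply: le_trans (ler_normB _ _) _.
  apply: (@le_trans _ _ ((`|c' i| + `|c i|) * (eps / (`|c i| + `|c' i| + 1)))).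
    rewrite mulrDl; apply: lerD; apply: le_trans (cauchy_schwarz _ _) _;
      by rewrite ler_wpM2l // ltW.
  rewrite mulrA ler_pdivrMr // mulrC ler_wpM2l ?(ltW eps0) //.
  by rewrite [leLHS]addrC lerDl.
move=> btot btot' gram.
have /choice[U UP] := half _ _ _ _ btot gram.
have /choice[V VP] := half _ _ _ _ btot' (fun i j => esym (gram i j)).
have UV : cancel V U.
  move=> v'; apply: (total_ext btot') => i.
  by have [_ ->] := UP (V v'); have [_ ->] := VP v'.
have VU : cancel U V.
  move=> v; apply: (total_ext btot) => i.
  by have [_ ->] := VP (U v); have [_ ->] := UP v.
have linU : linear U.
  move=> a u v; apply: (total_ext btot') => i.
  rewrite dotDr dotZr; have [_ ->] := UP u; have [_ ->] := UP v.
  by have [_ ->] := UP (a *: u + v); rewrite dotDr dotZr.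
exists U; split => //; first by exists V.
  by apply: isometry_dot => // u; have [] := UP u.
move=> i; apply: (total_ext btot') => j.
by have [_ ->] := UP (b i); rewrite gram.
Qed.

End Unitary.

(** * The inequality of Bessel and the identity of Parseval *)

Section Bessel.
Variables (R : realType) (H : hilbertType R) (I : eqType) (f : I -> H).
Hypothesis f_ortho : forall i j, i <> j -> '[f i, f j] = 0.

Let proj r v := \sum_(i <- r) '[v, f i] *: f i.
Let coefs r v := \sum_(i <- r) `|'[v, f i]| ^+ 2.

Lemma dot_ortho_sum r v i : uniq r -> i \in r ->
  '[\sum_(j <- r) '[v, f j] *: f j, f i] = '[v, f i] * `|f i| ^+ 2.
Proof.
move=> ur ir; rewrite dot_suml (bigD1_seq i) //= dotZl dotuu big1 ?addr0 // => j ji.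
by rewrite dotZl f_ortho ?mulr0 //; exact/eqP.
Qed.

(** Expand the square of the distance from [v] to the sum of its
    components. *)
Lemma bessel (r : seq I) v : uniq r -> (forall i, `|f i| <= 1) ->
  \sum_(i <- r) `|'[v, f i]| ^+ 2 <= `|v| ^+ 2.
Proof.
move=> ur f1.
have vw : '[v, proj r v] = coefs r v.
  rewrite dot_sumr; apply: eq_bigr => i _.
  by rewrite dotZr mulrC normCK.
have wv : '[proj r v, v] = coefs r v.
  rewrite dotC vw conj_Creal // rpred_sum // => i _.
  by rewrite rpredX // normr_real.
have ww : `|proj r v| ^+ 2 <= coefs r v.
  rewrite -dotuu [in X in '[_, X]]/proj dot_sumr /coefs big_seq [leRHS]big_seq.
  apply: ler_sum => i ir; rewrite dotZr dot_ortho_sum //.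
  rewrite mulrA [Num.conj _ * _]mulrC -normCK ler_piMr ?exprn_ge0 //.
  by rewrite exprn_ile1.
have : 0 <= `|v - proj r v| ^+ 2 by rewrite exprn_ge0.
rewrite norm_sqD normrN dotNr dotNl vw wv => h.
rewrite -subr_ge0; apply: le_trans h _.
by rewrite -[leLHS]addrA gerDl addrC subr_le0.
Qed.

(** The orthogonal projection onto the span of finitely many [f i] is the best
    approximation there, so the Fourier coefficients exhaust the norm of any
    vector of the closed span. *)
Lemma parseval v : (forall i, f i = 0 \/ `|f i| = 1) -> clspan f v ->
  forall eps : R[i], 0 < eps -> exists2 r : seq I, uniq r &
    `|v| ^+ 2 - eps <= \sum_(i <- r) `|'[v, f i]| ^+ 2.
Proof.
move=> f1 /closureP fv eps eps0.
have [d d0 d2] : exists2 d : R[i], 0 < d & d ^+ 2 <= eps.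
  exists (sqrtC eps); last by rewrite sqrtCK.
  by rewrite sqrtC_gt0.
have [_ [t [a ->]] vu] := fv d d0.
exists (undup t); first exact: undup_uniq.
set u := \sum_(i <- t) _ in vu; set w := proj (undup t) v.
have f11 i : '[v, f i] * `|f i| ^+ 2 = '[v, f i].
  by case: (f1 i) => ->; rewrite ?dot0r ?mul0r // expr1n mulr1.
have ort i : i \in t -> '[v - w, f i] = 0.
  move=> it; rewrite dotBl dot_ortho_sum ?undup_uniq ?mem_undup //.
  by rewrite f11 subrr.
have ortw : '[v - w, w] = 0.
  rewrite /w /proj dot_sumr big_seq big1 // => i; rewrite mem_undup => it.
  by rewrite dotZr ort // mulr0.
have ortu : '[v - w, u] = 0.
  by rewrite /u dot_sumr big_seq big1 // => i it; rewrite dotZr ort // mulr0.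
have le1 : `|v - w| ^+ 2 <= eps.
  apply: le_trans d2; apply: (@le_trans _ _ (`|v - u| ^+ 2)).
    have -> : v - u = (v - w) + (w - u) by rewrite subrKA.
    rewrite (@pythagoras _ _ (v - w) (w - u)) ?lerDl ?exprn_ge0 //.
    by rewrite dotBr ortw ortu subrr.
  by rewrite ler_pXn2r ?nnegrE // ?ltW // (le_lt_trans _ vu).
have -> : \sum_(i <- undup t) `|'[v, f i]| ^+ 2 = `|w| ^+ 2.
  rewrite -dotuu {2}/w /proj dot_sumr big_seq [RHS]big_seq; apply: eq_bigr => i.
  move=> ir; rewrite dotZr dot_ortho_sum ?undup_uniq // f11.
  by rewrite mulrC normCK.
rewrite lerBlDl -(lerD2r (`|w| ^+ 2)) in le1 *.
by rewrite -pythagoras // subrK in le1.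
Qed.

End Bessel.

(** By Bessel, [n] coefficients of modulus [c] take up [n * c ^+ 2] of the
    square of the norm, for every [n]. *)
Lemma bessel_constant (R : realType) (H : hilbertType R) (f : nat -> H) (v : H)
    (c : R[i]) :
  (forall n, `|f n| = 1) -> (forall m n, m <> n -> '[f m, f n] = 0) ->
  (forall n, `|'[v, f n]| = c) -> c = 0.
Proof.
move=> f1 fo vc; apply/eqP; apply: contraT => c0.
have c2 : 0 < c ^+ 2.
  by rewrite exprn_gt0 // lt_neqAle eq_sym c0 -(vc 0%N) normr_ge0.
have v1 : 0 < `|v| ^+ 2 + 1 by rewrite ltr_wpDl // exprn_ge0.
have [n0 /(_ n0 (leqnn _))] := invS_lt (divr_gt0 c2 v1).
rewrite ltr_pdivlMr // mulrC ltr_pdivrMr ?ltr0n // => lt_n.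
have f_le1 n : `|f n| <= 1 by rewrite f1.
have := bessel fo v (iota_uniq 0 n0.+1) f_le1.
under eq_bigr do rewrite vc.
rewrite big_const_seq count_predT size_iota iter_addr_0 -mulr_natr => le_n.
have := lt_le_trans lt_n le_n.
by rewrite gtrDl ltr10.
Qed.

Lemma parseval_esum (R : realType) (H : hilbertType R) (I : choiceType)
    (f : I -> H) (v : H) :
  (forall i j, i <> j -> '[f i, f j] = 0) -> (forall i, f i = 0 \/ `|f i| = 1) ->
  clspan f v ->
  (\esum_(i in [set: I]) (complex.Re (`|'[v, f i]| ^+ 2))%:E =
   (complex.Re (`|v| ^+ 2))%:E)%E.
Proof.
move=> fo f1 fv.
have f_le1 i : `|f i| <= 1 by case: (f1 i) => ->; rewrite ?normr0 ?ler01.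
have ReS (r : seq I) : (\sum_(i <- r) complex.Re (`|'[v, f i]| ^+ 2))%:C =
    \sum_(i <- r) `|'[v, f i]| ^+ 2.
  rewrite rmorph_sum; apply: eq_bigr => i _.
  by apply: RRe_real; rewrite rpredX // normr_real.
have ReV : (complex.Re (`|v| ^+ 2))%:C = `|v| ^+ 2.
  by apply: RRe_real; rewrite rpredX // normr_real.
apply/eqP; rewrite eq_le; apply/andP; split.
  apply: ge_ereal_sup => _ [X [finX _] <-].
  rewrite fsbig_finite //= sumEFin lee_fin -lecR ReS ReV.
  exact: bessel.
apply/lee_addgt0Pr => eps eps0.
have eps0' : 0 < eps%:C by rewrite ltcR.
have [r ur le_r] := parseval fo f1 fv eps0'.
rewrite -leeBlDr // -EFinB; apply: esum_ge; exists [set` r].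
  by split => //; exact: finite_seq.
rewrite -fsbig_seq // sumEFin lee_fin -lecR ReS rmorphB.
by rewrite [X in X - _]ReV.
Qed.

(** * Closed subspaces as Hilbert spaces *)

Section SubspaceHilbert.
Variables (R : realType) (H : hilbertType R) (M : set H).

(** The proof that the subspace is closed is part of the type, so that the
    Hilbert structure below can be inferred from the type alone. *)
Record subspace_of (cM : closed_subspace M) : Type :=
  SubspaceVector { sub_val : H; sub_valP : M sub_val }.

Variable cM : closed_subspace M.
Local Notation T := (subspace_of cM).

Lemma sub_val_inj : injective (@sub_val cM).
Proof.
move=> [u Mu] [v Mv] /= uv; case: _ / uv in Mv *.
by rewrite (Prop_irrelevance Mu Mv).
Qed.

HB.instance Definition _ := gen_eqMixin T.
HB.instance Definition _ := gen_choiceMixin T.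

Let zeroT : T := SubspaceVector cM (let: And3 M0 _ _ := cM in M0).
Let addT (u v : T) : T :=
  SubspaceVector cM (closed_subspaceD cM (sub_valP u) (sub_valP v)).
Let oppT (u : T) : T :=
  SubspaceVector cM (closed_subspaceN cM (sub_valP u)).
Let scaleT a (u : T) : T :=
  SubspaceVector cM (closed_subspaceZ a cM (sub_valP u)).

Fact sub_addA : associative addT.
Proof. by move=> u v w; apply: sub_val_inj; exact: addrA. Qed.
Fact sub_addC : commutative addT.
Proof. by move=> u v; apply: sub_val_inj; exact: addrC. Qed.
Fact sub_add0 : left_id zeroT addT.
Proof. by move=> u; apply: sub_val_inj; exact: add0r. Qed.
Fact sub_addN : left_inverse zeroT oppT addT.
Proof. by move=> u; apply: sub_val_inj; exact: addNr. Qed.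

HB.instance Definition _ :=
  GRing.isZmodule.Build T sub_addA sub_addC sub_add0 sub_addN.

Fact sub_scaleA a b (u : T) : scaleT a (scaleT b u) = scaleT (a * b) u.
Proof. by apply: sub_val_inj; exact: scalerA. Qed.
Fact sub_scale1 : left_id 1 scaleT.
Proof. by move=> u; apply: sub_val_inj; exact: scale1r. Qed.
Fact sub_scaleDr : right_distributive scaleT +%R.
Proof. by move=> a u v; apply: sub_val_inj; exact: scalerDr. Qed.
Fact sub_scaleDl (v : T) : {morph scaleT^~ v : a b / a + b}.
Proof. by move=> a b; apply: sub_val_inj; exact: scalerDl. Qed.

HB.instance Definition _ := GRing.Zmodule_isLmodule.Build R[i] T
  sub_scaleA sub_scale1 sub_scaleDr sub_scaleDl.

Let normT (u : T) : R[i] := `|sub_val u|.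

Fact sub_normD (u v : T) : normT (u + v) <= normT u + normT v.
Proof. exact: ler_normD. Qed.
Fact sub_normZ a (u : T) : normT (a *: u) = `|a| * normT u.
Proof. exact: normrZ. Qed.
Fact sub_norm0 (u : T) : normT u = 0 -> u = 0.
Proof. by move=> /normr0_eq0 u0; exact: sub_val_inj. Qed.

HB.instance Definition _ :=
  Lmodule_isNormed.Build R[i] T sub_normD sub_normZ sub_norm0.

Fact sub_complete (F : set_system T) : ProperFilter F -> cauchy F -> cvg F.
Proof.
move=> FF /cauchyP Fc.
have : cvg (@sub_val cM @ F).
  apply/cauchy_cvgP/cauchyP => eps eps0.
  have [u Fu] := Fc _ eps0; exists (sub_val u).
  rewrite /= /fmap /=; apply: filterS Fu => v /=.
  by rewrite -!ball_normE.
set l := lim _ => /cvgrPdist_lt Fl.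
have Ml : M l.
  have [_ _ clM] := cM; apply: clM; apply/closureP => eps eps0.
  have [u lu] := filter_ex (Fl _ eps0).
  by exists (sub_val u) => //; exact: sub_valP.
apply/cvg_ex; exists (SubspaceVector cM Ml).
apply/cvgrPdist_lt => eps eps0.
exact: Fl _ eps0.
Qed.

HB.instance Definition _ := Uniform_isComplete.Build T sub_complete.

Definition sub_dot (u v : T) : R[i] := '[sub_val u, sub_val v].

Fact sub_dotBl v : zmod_morphism (sub_dot^~ v).
Proof. by move=> u w; exact: dotBl. Qed.
Fact sub_dotBr u : zmod_morphism (sub_dot u).
Proof. by move=> v w; exact: dotBr. Qed.
Fact sub_dotZl v : scalable_for *%R (sub_dot^~ v).
Proof. by move=> a u; exact: dotZl. Qed.
Fact sub_dotZr u : scalable_for (Num.conj \; *%R) (sub_dot u).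
Proof. by move=> a v; exact: dotZr. Qed.

HB.instance Definition _ := isBilinear.Build R[i] T T R[i] *%R (Num.conj \; *%R)
  sub_dot sub_dotBl sub_dotBr sub_dotZl sub_dotZr.

Fact sub_dotC (u v : T) : sub_dot u v = (-1) ^+ false * Num.conj (sub_dot v u).
Proof. by rewrite expr0 mul1r; exact: dotC. Qed.

HB.instance Definition _ := isHermitianSesquilinear.Build R[i] T false (@Num.conj R[i])
  sub_dot sub_dotC.

Fact sub_dot_gt0 (u : T) : u != 0 -> 0 < sub_dot u u.
Proof.
move=> u0; rewrite /sub_dot dotuu exprn_gt0 // normr_gt0.
by apply: contra u0 => /eqP u0; apply/eqP/sub_val_inj.
Qed.

HB.instance Definition _ := isDotProduct.Build R[i] T sub_dot sub_dot_gt0.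

Let sub_dot_form : {dot T for (@Num.conj R[i])} := sub_dot.

Fact sub_dot_norm (u : T) : `|u| ^+ 2 = sub_dot_form u u.
Proof. by rewrite /= /sub_dot dotuu. Qed.

HB.instance Definition _ :=
  CompleteNormedModule_isHilbert.Build R T sub_dot_norm.

End SubspaceHilbert.

(** * Linear maps between Hilbert spaces *)

Lemma continuous_normP (R : realType) (H H' : hilbertType R) (f : H -> H') :
  continuous f <-> forall u (eps : R[i]), 0 < eps ->
    exists2 d : R[i], 0 < d & forall v, `|u - v| < d -> `|f u - f v| < eps.
Proof.
split=> [cf u eps eps0|cf u].
  have /cvgrPdist_lt/(_ _ eps0)/nbhs_normP[d d0 dP] := cf u.
  by exists d => // v uv; exact: dP.
apply/cvgrPdist_lt => eps eps0; have [d d0 dP] := cf u _ eps0.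
by apply/nbhs_normP; exists d => // v uv; exact: dP.
Qed.

Section LinearMaps.
Variables (R : realType) (H H' : hilbertType R) (f : H -> H').
Hypothesis linf : linear f.

Lemma linear_0 : f 0 = 0.
Proof. by have := linf (-1) 0 0; rewrite scaler0 addr0 scaleN1r addNr. Qed.
Lemma linear_Z a u : f (a *: u) = a *: f u.
Proof. by have := linf a u 0; rewrite linear_0 !addr0. Qed.
Lemma linear_D u v : f (u + v) = f u + f v.
Proof. by have := linf 1 u v; rewrite !scale1r. Qed.
Lemma linear_N u : f (- u) = - f u.
Proof. by rewrite -[in LHS]scaleN1r linear_Z scaleN1r. Qed.
Lemma linear_B u v : f (u - v) = f u - f v.
Proof. by rewrite linear_D linear_N. Qed.
Lemma linear_S (I : Type) (s : seq I) (P : pred I) (F : I -> H) :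
  f (\sum_(i <- s | P i) F i) = \sum_(i <- s | P i) f (F i).
Proof. exact: (big_morph f linear_D linear_0). Qed.

Lemma isometry_continuous : (forall u, `|f u| = `|u|) -> continuous f.
Proof.
move=> nf; apply/continuous_normP => u eps eps0; exists eps => // v.
by rewrite -linear_B nf.
Qed.

Lemma preimage_closed_subspace (M : set H') :
  continuous f -> closed_subspace M -> closed_subspace (f @^-1` M).
Proof.
move=> cf [M0 MZD cM]; split=> /= [|a u v Mu Mv|].
- by rewrite linear_0.
- by rewrite linf; exact: MZD.
- by apply: preimage_closed => // u _; exact: cf.
Qed.

Lemma isometry_norm : (forall u v, '[f u, f v] = '[u, v]) -> forall u, `|f u| = `|u|.
Proof.
by move=> df u; apply/eqP; rewrite -(@eqrXn2 _ 2%N) // -!dotuu df.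
Qed.

End LinearMaps.

(** * Doubly stochastic arrays *)

Section DoublyStochastic.
Variable R : realType.
Local Open Scope ereal_scope.
Local Open Scope card_scope.

Lemma esum_cst_fset (T : choiceType) (B : {fset T}) (D : set T)
    (a : T -> \bar R) (c : R) :
  [set` B] `<=` D -> (forall t, D t -> c%:E <= a t) ->
  (c *+ #|` B|)%:E <= \esum_(t in D) a t.
Proof.
move=> BD ca; apply: esum_ge; exists [set` B]; first by split.
rewrite fsbig_finite //= set_fsetK.
apply: (@le_trans _ _ (\sum_(t <- B) c%:E)).
  by rewrite sumEFin lee_fin big_const_seq count_predT iter_addr_0.
rewrite big_seq [leRHS]big_seq; apply: lee_sum => t tB.
exact/ca/BD.
Qed.

Lemma esum1_countable (T : choiceType) (a : T -> \bar R) :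
  (forall t, 0 <= a t) -> \esum_(t in [set: T]) a t = 1 ->
  countable [set t | a t != 0].
Proof.
move=> a0 a1.
pose B n := [set t | (n.+1%:R^-1)%:E <= a t].
apply: (@sub_countable _ _ _ (\bigcup_n B n)); last first.
  apply: bigcup_countable => // n _; apply: finite_set_countable.
  apply: contrapT => infB; have [X XB card_X] := infinite_set_fset n.+2 infB.
  have := esum_cst_fset XB (fun t (Bt : B n t) => Bt).
  move=> le1; have : (n.+1%:R^-1 *+ #|` X|)%:E <= 1 :> \bar R.
    rewrite -a1; apply: (le_trans le1).
    by rewrite [leLHS]esum_mkcond; apply: le_esum => t _; case: ifP.
  rewrite lee_fin -[X in (X <= _)%R]mulr_natl ler_pdivrMr ?ltr0n // mul1r ler_nat.
  by rewrite leqNgt card_X.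
apply: subset_card_le => t /= at0.
have at_gt0 : 0 < a t by rewrite lt_neqAle eq_sym at0 a0.
case E : (a t) at_gt0 => [r| |] //; last first.
  by move=> _; exists 0%N => //; rewrite /B /= E leey.
rewrite lte_fin => r0; exists (Num.bound r^-1) => //; rewrite /B /= E lee_fin.
rewrite -[leRHS]invrK lef_pV2 ?posrE ?invr_gt0 // ltW //.
apply: lt_le_trans (archi_boundP _) _; first by rewrite invr_ge0 ltW.
by rewrite ler_nat.
Qed.

Lemma esum_one_infinite (T : choiceType) (D : set T) : ~ finite_set D ->
  \esum_(t in D) (1 : \bar R) = +oo.
Proof.
move=> infD; apply/eqP; rewrite -leye_eq leNgt; apply/negP => lt_oo.
have s0 : 0 <= \esum_(t in D) (1 : \bar R) by apply: esum_ge0.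
case E : (\esum_(t in D) (1 : \bar R)) lt_oo s0 => [r| |] // _ r0.
have [B BD le_B] := infinite_set_fset (Num.bound r).+1 infD.
have := @esum_cst_fset _ _ _ (fun=> 1) 1%R BD (fun _ _ => lexx _).
rewrite E lee_fin leNgt => /negP; apply.
apply: lt_le_trans (archi_boundP _) _ => //.
by rewrite ler_nat (leq_trans _ le_B).
Qed.

(** The sum of ones over a set is its cardinal when that is finite, and infinite
    otherwise; a countable set is determined by this up to bijection. *)
Lemma esum_one_card (T U : choiceType) (C : set T) (D : set U) :
  countable C -> countable D ->
  \esum_(t in C) (1 : \bar R) = \esum_(u in D) 1 -> C #= D.
Proof.
move=> cC cD; have [finC|infC] := pselect (finite_set C).
  have [finD|infD] := pselect (finite_set D).
    rewrite !esum_fset // !fsbig_finite //= !sumEFin !big_const_seq !count_predT.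
    rewrite !iter_addr_0 => -[] /eqP; rewrite eqr_nat => /eqP e.
    exact/fcard_eq.
  rewrite (esum_one_infinite infD) esum_fset // fsbig_finite //= sumEFin.
  by [].
have [finD|infD] := pselect (finite_set D).
  rewrite (esum_one_infinite infC) esum_fset // fsbig_finite //= sumEFin.
  by [].
move=> _; apply: card_eq_trans (eq_card_nat cC infC) _.
by rewrite card_eq_sym; exact: eq_card_nat.
Qed.

Lemma esum_exchange (T U : choiceType) (C : set T) (D : set U) (a : T -> U -> \bar R) :
  (forall t u, 0 <= a t u) ->
  \esum_(t in C) \esum_(u in D) a t u = \esum_(u in D) \esum_(t in C) a t u.
Proof.
move=> a0; rewrite !esum_esum //.
apply: (@reindex_esum _ _ _ _ _ (fun p : U * T => (p.2, p.1)) (fun k => a k.1 k.2)).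
split=> [[u t] [] //|[u t] [u' t'] _ _ [-> ->] //|[t u] [] /= ? ?].
by exists (u, t).
Qed.

(** Mutual sharing of a column with a nonzero entry generates an equivalence on
    the rows; its classes are countable, because rows and columns have countable
    supports. Summing the entries of a class by rows and by columns shows that
    it has as many rows as columns, and countable sets are compared by these
    sums. *)
Lemma doubly_stochastic_bij (T U : choiceType) (a : T -> U -> \bar R) :
  (forall t u, 0 <= a t u) ->
  (forall t, \esum_(u in [set: U]) a t u = 1) ->
  (forall u, \esum_(t in [set: T]) a t u = 1) ->
  exists f : T -> U, bijective f.
Proof.
elim/choicePpointed: U => U in a * => a0 row col.
  have noU (u : U) : False by have := no u.
  have noT (t : T) : False.
    have := row t; rewrite esum1 => [/esym/eqP|u]; first by rewrite onee_eq0.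
    by case: (noU u).
  exists (fun t => match noT t with end), (fun u => match noU u with end) => [t|u].
    by case: (noT t).
  by case: (noU u).
pose r t u := a t u != 0.
pose stable (X : set T) := forall t t' u, X t -> r t u -> r t' u -> X t'.
pose cls t : set T := [set t' | forall X, stable X -> X t -> X t'].
have cls_refl t : cls t t by move=> X _.
have cls_stable t : stable (cls t).
  by move=> x x' u xx xu x'u X sX Xt; apply: (sX x x' u) => //; exact: xx.
have cls_trans t t' t'' : cls t t' -> cls t' t'' -> cls t t''.
  by move=> h; apply => //; exact: cls_stable.
have cls_sym t t' : cls t t' -> cls t' t.
  move=> h; apply: (h [set x | cls x t]) => //= x x' u xt xu x'u.
  apply: cls_trans xt.
  exact: (cls_stable x' x' x u).
have cls_eq t t' : cls t t' -> cls t = cls t'.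
  move=> h; apply/seteqP; split => x; apply: cls_trans => //.
  exact: cls_sym.
pose cols (C : set T) : set U := [set u | exists2 t, C t & r t u].
have cols_count C : countable C -> countable (cols C).
  move=> cC; have -> : cols C = \bigcup_(t in C) [set u | r t u] by [].
  by apply: bigcup_countable => // t _; exact: esum1_countable.
pose rows (D : set U) : set T := [set t | exists2 u, D u & r t u].
have rows_count D : countable D -> countable (rows D).
  move=> cD; have -> : rows D = \bigcup_(u in D) [set t | r t u] by [].
  by apply: bigcup_countable => // u _; exact: (esum1_countable (a := a^~ u)).
have cls_count t : countable (cls t).
  pose X n := iter n (rows \o cols) [set t].
  apply: (@sub_countable _ _ _ (\bigcup_n X n)).
    apply: subset_card_le => x; apply; last by exists 0%N.
    move=> y y' u [n _ Xy] yu y'u; exists n.+1 => //=.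
    by exists u => //; exists y.
  apply: bigcup_countable => // n _; elim: n => [|n IH]; first exact: countable1.
  exact/rows_count/cols_count.
have card_cls t : cls t #= cols (cls t).
  apply: esum_one_card => //; first exact: cols_count.
  pose C := cls t; pose D := cols C.
  have rowC x : C x -> \esum_(u in D) a x u = 1.
    move=> Cx; rewrite -(row x) esum_mkcond; apply: eq_esum => u _.
    case: ifPn => // /negP uD; apply/esym/eqP; apply: contrapT => /negP xu.
    by apply: uD; rewrite inE; exists x.
  have colD u : D u -> \esum_(x in C) a x u = 1.
    move=> [x Cx xu]; rewrite -(col u) esum_mkcond; apply: eq_esum => y _.
    case: ifPn => // /negP yC; apply/esym/eqP; apply: contrapT => /negP yu.
    by apply: yC; rewrite inE; exact: (cls_stable t x y u).
  rewrite -(eq_esum rowC) esum_exchange //; exact: eq_esum.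
have /choice[g gP] : forall C : set T, exists g : T -> U,
    (exists t, C = cls t) -> set_bij C (cols C) g.
  move=> C; have [[t ->]|nC] := pselect (exists t, C = cls t).
    by have /card_set_bijP[g gb] := card_cls t; exists g.
  by exists (fun=> point) => /nC.
pose f t := g (cls t) t.
have fP t : cols (cls t) (f t).
  by have [h _ _] := gP (cls t) (ex_intro _ t erefl); apply: h; exact: cls_refl.
exists f; rewrite -setTT_bijective; split=> // [t t' _ _ ff'|u _].
  have [[x tx xu] [x' tx' x'u]] := (fP t, fP t').
  have tt' : cls t = cls t'.
    apply: cls_eq; apply: cls_trans (cls_sym _ _ tx').
    by apply: (cls_stable t x x' (f t)) => //; rewrite ff'.
  have [_ h _] := gP (cls t) (ex_intro _ t erefl).
  apply: h; rewrite ?inE //; first by rewrite tt'.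
  by move: ff'; rewrite /f -tt'.
have [t tu] : exists t, r t u.
  apply: contrapT => nt; have := col u; rewrite esum1 => [/esym/eqP|t _].
    by rewrite onee_eq0.
  by apply/eqP; apply: contrapT => /negP tu; apply: nt; exists t.
have [_ _ h] := gP (cls t) (ex_intro _ t erefl).
have [|x tx xu] := h u; first by exists t.
by exists x => //; rewrite /f -(cls_eq _ _ tx).
Qed.

End DoublyStochastic.

(** * Shifts and periods of sequences *)

Definition shift T (n : nat) (K : nat -> T) : nat -> T := fun k => K (n + k)%N.
Definition cons_seq T (i : T) (K : nat -> T) : nat -> T :=
  fun n => if n is n'.+1 then K n' else i.

Lemma shift_shift T m n (K : nat -> T) : shift m (shift n K) = shift (n + m) K.
Proof. by apply/funext => k; rewrite /shift addnA. Qed.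
Lemma cons_shift T (K : nat -> T) n : cons_seq (K n) (shift n.+1 K) = shift n K.
Proof. by apply/funext => -[|k]; rewrite /shift /= ?addn0 // addSnnS. Qed.
Definition primitive_period T (K : nat -> T) p : Prop :=
  [/\ (0 < p)%N, shift p K = K & forall m, (0 < m < p)%N -> shift m K <> K].

Lemma period_iter T (K : nat -> T) p k : shift p K = K -> shift (k * p) K = K.
Proof. by move=> pK; elim: k => // k IH; rewrite mulSn -shift_shift pK. Qed.

Lemma primitive_inj T (K : nat -> T) p m n : primitive_period K p ->
  (m < p)%N -> (n < p)%N -> shift m K = shift n K -> m = n.
Proof.
move=> [_ pK prim]; wlog le_mn : m n / (m <= n)%N => [wl mp np mn|mp np mn].
  by have [le|/ltnW le] := leqP m n; [exact: wl|apply/esym/wl].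
apply/eqP; apply: contraT => ne; have lt_mn : (m < n)%N by rewrite ltn_neqAle ne.
exfalso; apply: (prim (m + (p - n))%N).
  by apply/andP; split; lia.
by rewrite -shift_shift mn shift_shift subnKC ?pK // ltnW.
Qed.

Section Periods.
Variables (T : Type).
Implicit Types (K : nat -> T).

(** Bezout, with natural numbers: [gcdn m n] plus a multiple of [n] is a
    multiple of [m]. *)
Lemma gcd_period K m n : (0 < m)%N -> shift m K = K -> shift n K = K ->
  shift (gcdn m n) K = K.
Proof.
move=> m0 mK nK; have [a _ /dvdnP[k e]] := Bezoutl n m0.
by rewrite -{1}(period_iter a nK) shift_shift addnC e period_iter.
Qed.

Lemma period_shift K p a : (0 < p)%N -> shift p K = K ->
  exists b, shift b (shift a K) = K.
Proof.
move=> p0 pK; exists (a * p - a)%N.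
by rewrite shift_shift subnKC ?period_iter // leq_pmulr.
Qed.

Lemma primitive_shift K p a : primitive_period K p -> primitive_period (shift a K) p.
Proof.
move=> [p0 pK prim]; split=> // [|m mp mK].
  by rewrite shift_shift addnC -shift_shift pK.
apply: (prim m mp); have [b bK] := period_shift a p0 pK.
by rewrite -{1}bK shift_shift addnC -shift_shift mK bK.
Qed.

Lemma primitive_uniq K p q : primitive_period K p -> primitive_period K q -> p = q.
Proof.
move=> [p0 pK primp] [q0 qK primq]; apply/eqP.
rewrite eqn_leq [(p <= q)%N]leqNgt [(q <= p)%N]leqNgt.
apply/andP; split; apply/negP => h.
  by apply: (primp q) => //; rewrite q0.
by apply: (primq p) => //; rewrite p0.
Qed.

Lemma exists_primitive K p : (0 < p)%N -> shift p K = K ->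
  exists q, primitive_period K q.
Proof.
move=> p0 pK; have : exists q, `[< (0 < q)%N /\ shift q K = K >].
  by exists p; apply/asboolP.
move=> /ex_minnP[q /asboolP[q0 qK] qmin]; exists q; split => // m /andP[m0 mq] mK.
by have := qmin m (asboolT (conj m0 mK)); rewrite leqNgt mq.
Qed.

Lemma mkseq_mul K g k : shift g K = K ->
  mkseq K (k * g) = flatten (nseq k (mkseq K g)).
Proof.
move=> gK; elim: k => // k IH; rewrite mulSn /= -IH /mkseq iotaD map_cat add0n.
by congr (_ ++ _); rewrite -[X in iota X _]addn0 iotaDl -map_comp -[in RHS]gK.
Qed.

End Periods.

Section RepeatWord.
Variables (N : nat) (x0 : 'I_N).
Implicit Types (K : nat -> 'I_N).

Definition repeat_word (J : seq 'I_N) : nat -> 'I_N := fun n => nth x0 J (n %% size J).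

Lemma repeat_word_period J : shift (size J) (repeat_word J) = repeat_word J.
Proof. by apply/funext => n; rewrite /shift /repeat_word modnDl. Qed.

Lemma mkseq_repeat_word J : mkseq (repeat_word J) (size J) = J.
Proof.
apply: (@eq_from_nth _ x0); rewrite size_mkseq // => i iJ.
by rewrite nth_mkseq // /repeat_word modn_small.
Qed.

Lemma repeat_word_mkseq K p : (0 < p)%N -> shift p K = K ->
  repeat_word (mkseq K p) = K.
Proof.
move=> p0 pK; apply/funext => n; rewrite /repeat_word size_mkseq.
rewrite nth_mkseq ?ltn_mod // {2}(divn_eq n p).
by rewrite -[in LHS](period_iter (n %/ p) pK).
Qed.

End RepeatWord.

(** * Minimal non periodic words *)

Section Words.
Variables (N : nat) (A : 'M[bool]_N) (x0 : 'I_N).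
Implicit Types (J w : seq 'I_N) (K L M : nat -> 'I_N).

(** Reading the letters as digits in base [N], with the first letter the most
    significant: this is the weight compared by minimality. *)
Fixpoint word_value J : nat :=
  if J is i :: J' then (i * N ^ size J' + word_value J')%N else 0%N.

Lemma word_value_lt J : (word_value J < N ^ size J)%N.
Proof.
elim: J => //= i J IH; rewrite expnS.
apply: (@leq_trans (i.+1 * N ^ size J)%N); first by rewrite mulSn addnC ltn_add2r.
by rewrite leq_mul2r ltn_ord orbT.
Qed.

Lemma word_value_inj J J' : size J = size J' -> word_value J = word_value J' -> J = J'.
Proof.
elim: J J' => [|i J IH] [|i' J'] //= [sJ].
have lt := word_value_lt J; have lt' := word_value_lt J'; rewrite -sJ in lt'.
have P0 : (0 < N ^ size J)%N by apply: leq_ltn_trans lt.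
rewrite -sJ => e; have ii : i = i'.
  apply/val_inj => /=; have /(congr1 (divn^~ (N ^ size J)%N)) := e.
  by rewrite !divnMDl // !divn_small // !addn0.
by by move: e; rewrite ii => /addnI /(IH _ sJ) ->.
Qed.

Lemma minimal_wordE J :
  minimal_word J <-> forall r, (word_value J <= word_value (rot r J))%N.
Proof.
have sumE (L : seq 'I_N) : \sum_(l < size L) letter L l * N%:Z ^+ (size L - l.+1) =
    (word_value L)%:Z.
  elim: L => [|i L IH]; first by rewrite big_ord0.
  rewrite /= big_ord_recl /= subSS subn0 PoszD PoszM -IH; congr (_ * _ + _).
    by rewrite rmorphXn.
have E r : \sum_(l < size J)
    (letter (rot r J) l - letter J l) * N%:Z ^+ (size J - l.+1) =
    (word_value (rot r J))%:Z - (word_value J)%:Z.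
  rewrite -!sumE size_rot -sumrB; apply: eq_bigr => l _.
  by rewrite mulrBl.
by split=> h r; have := h r; rewrite E subr_ge0 lez_nat.
Qed.

Lemma mkseq_shift_repeat J r : (r < size J)%N ->
  mkseq (shift r (repeat_word x0 J)) (size J) = rot r J.
Proof.
move=> rJ; apply: (@eq_from_nth _ x0); rewrite size_mkseq ?size_rot // => i iJ.
rewrite nth_mkseq // /shift /repeat_word nth_cat size_drop.
have [lt|le] := ltnP i (size J - r).
  by rewrite nth_drop modn_small // -ltn_subRL.
have le_r : (size J <= r + i)%N by lia.
rewrite nth_take; last by lia.
rewrite (_ : (i - (size J - r) = r + i - size J)%N); last by lia.
by rewrite -{1}(subnK le_r) modnDr modn_small //; lia.
Qed.

Lemma nonperiodic_primitive J : J != [::] -> ~ periodic_word J ->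
  primitive_period (repeat_word x0 J) (size J).
Proof.
rewrite -size_eq0 -lt0n => J0 nper.
have pK := repeat_word_period x0 J; split => // m /andP[m0 mp] mK.
apply: nper; have gK := gcd_period m0 mK pK; set g := gcdn m _ in gK.
have g0 : (0 < g)%N by rewrite gcdn_gt0 m0.
have gp : (g %| size J)%N by rewrite dvdn_gcdr.
exists (mkseq (repeat_word x0 J) g), (size J %/ g)%N; split.
- by rewrite -size_eq0 size_mkseq -lt0n.
- rewrite ltn_divRL // mul1n; apply: leq_ltn_trans mp.
  by apply: dvdn_leq => //; exact: dvdn_gcdl.
- by have := mkseq_mul (size J %/ g)%N gK; rewrite divnK // mkseq_repeat_word.
Qed.

Lemma primitive_nonperiodic J : J != [::] ->
  primitive_period (repeat_word x0 J) (size J) -> ~ periodic_word J.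
Proof.
move=> J0 [_ _ prim] [w [m [w0 m1 JE]]].
have w0' : (0 < size w)%N by rewrite lt0n size_eq0.
have pw := repeat_word_period x0 w.
have JE' : J = mkseq (repeat_word x0 w) (m * size w).
  by rewrite mkseq_mul // mkseq_repeat_word.
have sJ : size J = (m * size w)%N by rewrite JE' size_mkseq.
have JW : repeat_word x0 J = repeat_word x0 w.
  rewrite JE' repeat_word_mkseq // ?period_iter // muln_gt0 w0' andbT.
  exact: leq_trans m1.
apply: (prim (size w)); last by rewrite JW.
by rewrite w0' sJ ltn_Pmull.
Qed.

(** The least period of the tail is the length of the word, and the tail shows
    the word up to rotation; words that are both minimal and rotations of each
    other have the same value. *)
Lemma cycle_word_uniq J J' a b : J != [::] -> J' != [::] ->
  minimal_word J -> minimal_word J' -> ~ periodic_word J -> ~ periodic_word J' ->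
  shift a (repeat_word x0 J) = shift b (repeat_word x0 J') -> J = J'.
Proof.
move=> J0 J0' /minimal_wordE mJ /minimal_wordE mJ' nJ nJ' ab.
have pJ := nonperiodic_primitive J0 nJ; have pJ' := nonperiodic_primitive J0' nJ'.
have sJ : size J = size J'.
  apply: (primitive_uniq (primitive_shift a pJ)); rewrite ab.
  exact: primitive_shift.
have half (L L' : seq 'I_N) c d : primitive_period (repeat_word x0 L) (size L) ->
    primitive_period (repeat_word x0 L') (size L') -> size L = size L' ->
    (forall r, (word_value L <= word_value (rot r L))%N) ->
    shift c (repeat_word x0 L) = shift d (repeat_word x0 L') ->
    (word_value L <= word_value L')%N.
  move=> [L0 pL _] [L0' pL' _] sL mL cd.
  have [e eE] := period_shift d L0' pL'.
  rewrite -(mkseq_repeat_word x0 L') -eE -cd -sL shift_shift.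
  rewrite (divn_eq (c + e) (size L)) -shift_shift period_iter //.
  by rewrite mkseq_shift_repeat ?ltn_mod.
apply: word_value_inj => //; apply/eqP; rewrite eqn_leq.
by rewrite (half _ _ _ _ pJ pJ' sJ mJ ab) (half _ _ _ _ pJ' pJ (esym sJ) mJ' (esym ab)).
Qed.

Lemma admissible_mkseq K p : (0 < p)%N -> shift p K = K -> admissible_sequence A K ->
  admissible_cycle A (mkseq K p).
Proof.
case: p => // p _ pK admK; rewrite /admissible_cycle /=.
rewrite (_ : rcons _ _ = [seq K i | i <- iota 1 p.+1]); last first.
  rewrite -[p.+1 in RHS]addn1 iotaD map_cat /= cats1; congr rcons.
  by rewrite add1n -[in LHS]pK /shift addn0.
apply/(pathP x0) => i; rewrite size_map size_iota => ip.
rewrite (nth_map 0%N) ?size_iota // nth_iota // add1n.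
suff -> : nth x0 (K 0%N :: [seq K i | i <- iota 1 p.+1]) i = K i by exact: admK.
case: i ip => // i ip.
rewrite -[LHS]/(nth x0 [seq K i | i <- iota 1 p.+1] i).
by rewrite (nth_map 0%N) ?size_iota 1?ltnW // nth_iota 1?ltnW // add1n.
Qed.

(** Take the least period, and the least among the words that the rotations show
    over this period. *)
Lemma exists_cycle_word K p : (0 < p)%N -> shift p K = K ->
  exists r J, [/\ J != [::], minimal_word J, ~ periodic_word J
    & shift r K = repeat_word x0 J].
Proof.
move=> p0 pK; have [q primq] := exists_primitive p0 pK; have [q0 qK _] := primq.
pose val r := word_value (mkseq (shift r K) q).
have [r _ rmin] := @arg_minnP _ (Ordinal q0) xpredT (fun r : 'I_q => val r) isT.
have qrK := (primitive_shift r primq); have [_ qr _] := qrK.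
exists (r : nat), (mkseq (shift r K) q).
have J0 : mkseq (shift r K) q != [::] by rewrite -size_eq0 size_mkseq -lt0n.
have rw : shift r K = repeat_word x0 (mkseq (shift r K) q).
  by rewrite repeat_word_mkseq.
split => //; last first.
  by apply: primitive_nonperiodic => //; rewrite -rw size_mkseq.
apply/minimal_wordE => t.
have [tq|qt] := ltnP t q; last by rewrite rot_oversize // size_mkseq.
rewrite -mkseq_shift_repeat ?size_mkseq // -rw shift_shift.
rewrite (divn_eq (r + t) q) -shift_shift period_iter //.
exact: (rmin (Ordinal (ltn_pmod (r + t) q0)) isT).
Qed.

(** * Tail equivalence *)

Lemma tail_equivalentP K L :
  tail_equivalent K L <-> exists a b, shift a K = shift b L.
Proof.
have catE w M : shift (size w) (cat_sequence w M) = M.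
  by apply/funext => n; rewrite /shift /cat_sequence nth_default ?leq_addr // addKn.
have catV M a : M = cat_sequence (mkseq M a) (shift a M).
  apply/funext => n; rewrite /cat_sequence size_mkseq /shift.
  have [na|an] := ltnP n a; first by rewrite nth_mkseq.
  by rewrite nth_default ?size_mkseq // subnKC.
split=> [[w [w' [M [-> ->]]]]|[a [b ab]]].
  by exists (size w), (size w'); rewrite !catE.
by exists (mkseq K a), (mkseq L b), (shift a K); split; rewrite // ab.
Qed.

Lemma tail_equivalent_sym K L : tail_equivalent K L -> tail_equivalent L K.
Proof. by move=> /tail_equivalentP[a [b ab]]; apply/tail_equivalentP; exists b, a. Qed.

Lemma tail_equivalent_trans K L M :
  tail_equivalent K L -> tail_equivalent L M -> tail_equivalent K M.
Proof.
move=> /tail_equivalentP[a [b ab]] /tail_equivalentP[c [d cd]].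
apply/tail_equivalentP; exists (a + c)%N, (d + b)%N.
by rewrite -!shift_shift ab -cd !shift_shift addnC.
Qed.

Lemma tail_class_eq K L : tail_equivalent K L -> tail_class A K = tail_class A L.
Proof.
move=> KL; apply/seteqP; split=> M [aM e]; split=> //.
  exact: tail_equivalent_trans (tail_equivalent_sym KL) e.
exact: tail_equivalent_trans KL e.
Qed.

Lemma tail_class_mem K : admissible_sequence A K -> tail_class A K K.
Proof. by move=> aK; split=> //; apply/tail_equivalentP; exists 0%N, 0%N. Qed.

End Words.

(** * The operators of a representation *)

Section Reps.
Variables (R : realType) (N : nat) (A : 'M[bool]_N).
Variables (O : cstarAlgType R) (s : 'I_N -> O).
Implicit Types pi rho : representation O.

Definition raise pi i : pi -> pi := rep_op (s i).
Definition lower pi i : pi -> pi := rep_op (star (s i)).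

Lemma rep_op_linear pi x : linear (@rep_op _ _ pi x).
Proof. by have [h _ _ _ _] := rep_opP pi; case: (h x). Qed.
Lemma rep_op_continuous pi x : continuous (@rep_op _ _ pi x).
Proof. by have [h _ _ _ _] := rep_opP pi; case: (h x). Qed.
Lemma rep_op_linearl pi v : linear (fun x => @rep_op _ _ pi x v).
Proof. by have [_ h _ _ _] := rep_opP pi. Qed.
Lemma rep_opM pi x y v : @rep_op _ _ pi (x * y) v = rep_op x (rep_op y v).
Proof. by have [_ _ h _ _] := rep_opP pi. Qed.
Lemma rep_op1 pi v : @rep_op _ _ pi 1 v = v.
Proof. by have [_ _ _ h _] := rep_opP pi. Qed.
Lemma rep_op_adj pi x u v : '[@rep_op _ _ pi x u, v] = '[u, rep_op (star x) v].
Proof. by have [_ _ _ _ h] := rep_opP pi; exact: h. Qed.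
Lemma rep_op_adjV pi x u v : '[@rep_op _ _ pi (star x) u, v] = '[u, rep_op x v].
Proof. by rewrite rep_op_adj starK. Qed.

Lemma rep_op_suml pi (I : finType) (F : I -> O) v :
  @rep_op _ _ pi (\sum_i F i) v = \sum_i rep_op (F i) v.
Proof.
have D x y : @rep_op _ _ pi (x + y) v = rep_op x v + rep_op y v.
  by rewrite -{1}[x]scale1r rep_op_linearl scale1r.
apply: (big_morph (fun x => @rep_op _ _ pi x v) D).
have := D 0 0; rewrite addr0 => /(congr1 (fun w => w - rep_op 0 v)).
by rewrite subrr addrK => <-.
Qed.

Lemma rep_op_Zl pi a x v : @rep_op _ _ pi (a *: x) v = a *: rep_op x v.
Proof.
have h0 : @rep_op _ _ pi 0 v = 0.
  have := rep_op_linearl v (-1) 0 0.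
  by rewrite scaler0 addr0 scaleN1r addNr.
by have := rep_op_linearl v a x 0; rewrite h0 !addr0.
Qed.

(** * Consequences of the universal property *)

Hypothesis hO : is_cuntz_krieger A s.

Lemma rep_ck_family pi : ck_family A (@raise pi) (@lower pi).
Proof.
have [[h1 h2 h3] _] := hO; split.
- move=> i; have [h _ _ _ h5] := rep_opP pi.
  by split; [exact: h|exact: h|exact: h5].
- by move=> i v; rewrite /raise /lower -!rep_opM h1.
- move=> i v; rewrite /raise /lower -!rep_opM h2 rep_op_suml; apply: eq_bigr => j _.
  by rewrite rep_op_Zl rep_opM.
- move=> v; rewrite -[RHS]rep_op1 -h3 rep_op_suml; apply: eq_bigr => j _.
  by rewrite rep_opM.
Qed.

(** Conjugation by the unitary turns [rho] into a representation on the space of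
    [pi] with the same values on the generators, and the extension from the
    generators to the algebra is unique. *)
Lemma intertwiner pi rho (U : pi -> rho) : linear U -> bijective U ->
  (forall u v, '[U u, U v] = '[u, v]) -> (forall i v, U (raise i v) = raise i (U v)) ->
  forall x v, U (rep_op x v) = rep_op x (U v).
Proof.
move=> linU [V UK VK] dU US.
have linV : linear V.
  by move=> a u v; apply: (can_inj UK); rewrite linU !VK.
have dV u v : '[V u, V v] = '[u, v] by rewrite -dU !VK.
have cU := isometry_continuous linU (isometry_norm dU).
have cV := isometry_continuous linV (isometry_norm dV).
pose op x v := V (@rep_op _ _ rho x (U v)).
have repop : star_representation op.
  split; rewrite /op.
  - move=> x; split=> [a u v|]; first by rewrite linU rep_op_linear linV.
    move=> v; apply: continuous_comp; last exact: cV.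
    apply: continuous_comp; last exact: rep_op_continuous.
    exact: cU.
  - by move=> v a x y; rewrite rep_op_linearl linV.
  - by move=> x y v; rewrite VK rep_opM.
  - by move=> v; rewrite rep_op1 UK.
  - by move=> x u v; rewrite -[v in LHS]UK dV rep_op_adj -[u in RHS]UK dV.
have [op0 [_ op0_uniq]] := hO.2 _ _ _ (rep_ck_family pi).
have e1 : op0 = @rep_op _ _ pi by apply: op0_uniq; split => //; exact: rep_opP.
have e2 : op0 = op.
  apply: op0_uniq; split => // i; apply/funext => v.
  by rewrite /op -[rep_op _ _]/(raise i _) -US UK.
by move=> x v; rewrite -e1 e2 /op VK.
Qed.

Definition reducing pi (M : set pi) : Prop :=
  closed_subspace M /\ forall i v, M v -> M (raise i v) /\ M (lower i v).

(** With [P] the projection onto [M], the symmetry [2 P - 1] is a unitary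
    commuting with the generators, so it commutes with the whole algebra. *)
Lemma reducing_invariant pi (M : set pi) : reducing M ->
  forall x v, M v -> M (rep_op x v).
Proof.
move=> [cM MS].
suff [P [PM PK PS]] : exists P : pi -> pi, [/\ forall v, M (P v),
    forall v, M v -> P v = v & forall x v, P (rep_op x v) = rep_op x (P v)].
  by move=> x v Mv; rewrite -[v]PK // -PS.
have /choice[P P_spec] : forall v, exists p, M p /\ forall m, M m -> '[v - p, m] = 0.
  by move=> v; have [p] := orthogonal_projection v cM; exists p.
have PM v : M (P v) by case: (P_spec v).
have Porth v m : M m -> '[v - P v, m] = 0 by case: (P_spec v) => _; apply.
have Puniq v p : M p -> (forall m, M m -> '[v - p, m] = 0) -> P v = p.
  move=> Mp porth; apply/eqP; rewrite -subr_eq0; apply/eqP/dot_uu0.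
  have MB : M (P v - p) by exact: closed_subspaceB.
  rewrite -[X in '[X, _]](_ : (v - p) - (v - P v) = _).
    by rewrite dotBl porth // Porth // subrr.
  by rewrite opprB addrC subrKA.
have PK v : M v -> P v = v.
  by move=> Mv; apply: Puniq => // m _; rewrite subrr dot0l.
have linP : linear P.
  move=> a u v; apply: Puniq => [|m Mm].
    by case: (cM) => _ h _; exact: h.
  by rewrite opprD addrACA -scalerBr dotDl dotZl !Porth // mulr0 addr0.
have PSi i v : P (raise i v) = raise i (P v).
  apply: Puniq => [|m Mm]; first by case: (MS i (P v)).
  rewrite -(linear_B (@rep_op_linear pi (s i))) rep_op_adj Porth //.
  by case: (MS i m).
(* Unlike [P], its symmetry [2 P - 1] is unitary. *)
pose U v := 2 *: P v - v.
have linU : linear U.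
  by move=> a u v; rewrite /U linP scalerDr scalerBr opprD addrACA !scalerA mulrC.
have UK : involutive U.
  move=> v; rewrite /U (linear_B linP) (linear_Z linP) (PK (P v)) //.
  by rewrite scalerBr !scaler_nat !mulr2n addrK opprB addrC subrK.
have dU u v : '[U u, U v] = '[u, v].
  have split1 w : U w = P w - (w - P w).
    by rewrite /U scaler_nat mulr2n opprB addrA.
  have o1 : '[P u, v - P v] = 0 by apply: dot_sym0; exact: Porth.
  have o2 : '[u - P u, P v] = 0 by exact: Porth.
  have flip (p q p' q' : pi) : '[p, q'] = 0 -> '[q, p'] = 0 ->
      '[p - q, p' - q'] = '[p + q, p' + q'].
    move=> h1 h2; rewrite dotBl dotDl !dotBr !dotDr h1 h2.
    by rewrite subr0 sub0r opprK addr0 add0r.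
  by rewrite !split1 flip // [P u + _]addrC [P v + _]addrC !subrK.
have US i v : U (raise i v) = raise i (U v).
  by rewrite /U PSi /raise (linear_B (rep_op_linear _)) (linear_Z (rep_op_linear _)).
have Uop := intertwiner linU (inv_bij UK) dU US.
exists P; split=> // x v.
apply: (@scalerI _ _ 2); first by rewrite pnatr_eq0.
have := Uop x v; rewrite /U (linear_B (rep_op_linear _)) (linear_Z (rep_op_linear _)).
by move=> /addIr.
Qed.

(** * The cyclic subspace of a vector *)

Definition cyc pi (v : pi) : set pi := closure (range (fun x : O => rep_op x v)).

Lemma cycE pi (v : pi) : cyc v = clspan (fun x : O => rep_op x v).
Proof.
congr closure; apply/seteqP; split => [_ [x _ <-]|_ [t [a ->]]].
  by exists [:: x], (fun=> 1); rewrite big_seq1 scale1r.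
exists (\sum_(x <- t) a x *: x) => //.
elim: t => [|x t IH]; last by rewrite !big_cons rep_op_linearl IH.
by rewrite !big_nil -(scale0r (1 : O)) rep_op_Zl scale0r.
Qed.

Lemma cyc_closed pi (v : pi) : closed_subspace (cyc v).
Proof. by rewrite cycE; exact: clspan_closed. Qed.

Lemma cyc_op pi (v : pi) x u : cyc v u -> cyc v (rep_op x u).
Proof.
have cP : closed_subspace (@rep_op _ _ pi x @^-1` cyc v).
  apply: preimage_closed_subspace; first exact: rep_op_linear.
    exact: rep_op_continuous.
  by rewrite cycE; exact: clspan_closed.
rewrite [in cyc v u]cycE => vu; apply: (clspan_min cP) vu => y /=.
by rewrite cycE -rep_opM; exact: (@clspan_mem _ _ _ (fun z : O => rep_op z v)).
Qed.

Lemma cyc_reducing pi (v : pi) : reducing (cyc v).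
Proof. by split; [exact: cyc_closed|move=> i u cu; split; exact: cyc_op]. Qed.

Lemma cyc_refl pi (v : pi) : cyc v v.
Proof.
by rewrite cycE -{2}[v]rep_op1; exact: (@clspan_mem _ _ _ (fun z : O => rep_op z v)).
Qed.

(** By [reducing_invariant] the cyclic subspace is the least reducing subspace
    through the vector, so that it can be computed with generators only. *)
Lemma cyc_min pi (M : set pi) v : reducing M -> M v -> cyc v `<=` M.
Proof.
move=> rM Mv; rewrite cycE; apply: clspan_min; first by case: rM.
by move=> x; exact: reducing_invariant.
Qed.

Lemma cyc_sub pi (u v : pi) : cyc v u -> cyc u `<=` cyc v.
Proof. exact: cyc_min (cyc_reducing v). Qed.

Lemma cyc_eq pi (u v : pi) : cyc v u -> cyc u v -> cyc u = cyc v.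
Proof. by move=> uv vu; apply/seteqP; split; exact: cyc_sub. Qed.

(** * Subrepresentations *)

Section Subrepresentation.
Variables (pi : representation O) (M : set pi) (cM : closed_subspace M).
Hypothesis MO : forall x v, M v -> M (rep_op x v).

Definition sub_op (x : O) (v : subspace_of cM) : subspace_of cM :=
  SubspaceVector cM (MO x (sub_valP v)).

Lemma sub_opP : star_representation sub_op.
Proof.
split.
- move=> x; have linx : linear (sub_op x).
    by move=> a u v; apply: sub_val_inj; exact: rep_op_linear.
  have /continuous_normP cx := @rep_op_continuous pi x.
  split=> //; apply/continuous_normP => u eps eps0.
  by have [d d0 dP] := cx (sub_val u) _ eps0; exists d => // v; exact: dP.
- by move=> v a x y; apply: sub_val_inj; exact: rep_op_linearl.
- by move=> x y v; apply: sub_val_inj; exact: rep_opM.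
- by move=> v; apply: sub_val_inj; exact: rep_op1.
- by move=> x u v; exact: rep_op_adj.
Qed.

Definition subrep : representation O :=
  @Representation R O (subspace_of cM) sub_op sub_opP.

End Subrepresentation.

Definition cyc_rep pi (v : pi) : representation O :=
  subrep (@cyc_closed pi v) (@cyc_op pi v).

Definition cyc_vector pi (v : pi) : cyc_rep v :=
  SubspaceVector _ (@cyc_refl pi v).

Definition cyc_incl pi (v : pi) : cyc_rep v -> pi := 
  @sub_val R pi (cyc v) (@cyc_closed pi v).

Lemma cyc_vector_cyclic pi (v : pi) : cyclic_vector (cyc_vector v).
Proof.
apply/seteqP; split => // w _; apply/closureP => eps eps0.
have /closureP/(_ _ eps0)[_ [x _ <-] lt_e] := sub_valP w.
by exists (rep_op x (cyc_vector v)) => //; exists x.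
Qed.

End Reps.

(** * The Cuntz-Krieger relations for vectors *)

Section Coded.
Variables (R : realType) (N : nat) (A : 'M[bool]_N).
Variables (O : cstarAlgType R) (s : 'I_N -> O).
Hypothesis hO : is_cuntz_krieger A s.
Implicit Types pi rho : representation O.
Implicit Types (K L : nat -> 'I_N) (w : seq 'I_N).
Local Notation raise := (raise s).
Local Notation lower := (lower s).

Lemma raise_linear pi i : linear (raise i : pi -> pi).
Proof. exact: rep_op_linear. Qed.
Lemma lower_linear pi i : linear (lower i : pi -> pi).
Proof. exact: rep_op_linear. Qed.
Lemma dot_raise pi i (u v : pi) : '[raise i u, v] = '[u, lower i v].
Proof. exact: rep_op_adj. Qed.
Lemma dot_lower pi i (u v : pi) : '[lower i u, v] = '[u, raise i v].
Proof. exact: rep_op_adjV. Qed.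
Lemma raise0 pi i : raise i (0 : pi) = 0.
Proof. by rewrite (linear_0 (raise_linear i)). Qed.
Lemma lower0 pi i : lower i (0 : pi) = 0.
Proof. by rewrite (linear_0 (lower_linear i)). Qed.
Lemma raiseZ pi i a (v : pi) : raise i (a *: v) = a *: raise i v.
Proof. by rewrite (linear_Z (raise_linear i)). Qed.
Lemma lowerZ pi i a (v : pi) : lower i (a *: v) = a *: lower i v.
Proof. by rewrite (linear_Z (lower_linear i)). Qed.

Lemma raiseK pi i (v : pi) : raise i (lower i (raise i v)) = raise i v.
Proof. by have [_ h _ _] := rep_ck_family hO pi; exact: h. Qed.
Lemma lower_raise pi i (v : pi) :
  lower i (raise i v) = \sum_(j < N) (A i j)%:R *: raise j (lower j v).
Proof. by have [_ _ h _] := rep_ck_family hO pi; exact: h. Qed.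
Lemma sum_raise_lower pi (v : pi) : \sum_(i < N) raise i (lower i v) = v.
Proof. by have [_ _ _ h] := rep_ck_family hO pi; exact: h. Qed.
(** Taking adjoints in the relation s s* s = s. *)
Lemma lowerK pi i (v : pi) : lower i (raise i (lower i v)) = lower i v.
Proof.
by apply: dot_ext => u; rewrite dot_lower dot_raise dot_lower raiseK dot_lower.
Qed.

(** The range projections are idempotent and sum to the identity, so they are
    mutually orthogonal: [|v|^2] is already the contribution of one of them
    when [v] lies in its range. *)
Lemma lower_raise_neq pi i j (v : pi) : i != j -> lower i (raise j v) = 0.
Proof.
move=> ij; set w := raise j v.
have sq k : '[raise k (lower k w), w] = `|raise k (lower k w)| ^+ 2.
  by rewrite -dotuu dot_raise dot_raise lowerK.
have sum0 : \sum_(k < N | k != j) `|raise k (lower k w)| ^+ 2 = 0.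
  have : \sum_(k < N) '[raise k (lower k w), w] = '[w, w].
    by rewrite -dot_suml sum_raise_lower.
  rewrite (bigD1 j) //= /w raiseK -/w => /(canRL (addKr _)).
  rewrite addNr => {2}<-; apply: eq_bigr => k _.
  by rewrite -sq.
have /eqP := sum0; rewrite psumr_eq0; last by move=> k _; rewrite exprn_ge0.
move=> /allP/(_ i (mem_index_enum _)); rewrite ij /= expf_eq0 /= normr_eq0.
by move=> /eqP h; rewrite -lowerK h lower0.
Qed.

Lemma dot_raise_neq pi i j (u v : pi) : i != j -> '[raise i u, raise j v] = 0.
Proof. by move=> ij; rewrite dot_raise lower_raise_neq // dot0r. Qed.

(** On vectors with first letter [h] the sum of range projections in the
    relation for s_i* s_i has a single term. *)
Lemma lower_raise_in pi i h (v : pi) : raise h (lower h v) = v ->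
  lower i (raise i v) = (A i h)%:R *: v.
Proof.
move=> hv; rewrite lower_raise (bigD1 h) //= hv big1 ?addr0 // => j jh.
by rewrite -hv lower_raise_neq // raise0 scaler0.
Qed.

Lemma raise_eq0 pi i (v : pi) : lower i (raise i v) = 0 -> raise i v = 0.
Proof. by move=> h; rewrite -raiseK h raise0. Qed.

(** [lower i \o raise i] is an orthogonal projection, and a projection that
    preserves the norm of a vector fixes it. *)
Lemma lower_raise_norm pi i (v : pi) : `|raise i v| = `|v| -> lower i (raise i v) = v.
Proof.
move=> nv; set p := lower i (raise i v).
have pp : '[p, v] = '[p, p] by rewrite /p !dot_lower raiseK.
have npv : '[p, p] = '[v, v].
  by rewrite -pp /p dot_lower !dotuu nv.
apply/eqP; rewrite -subr_eq0; apply/eqP/dot_uu0.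
rewrite dotBl !dotBr pp [X in _ - (X - _)]dotC pp npv dotuu.
by rewrite conj_Creal ?subrr ?subr0 ?rpredX ?normr_real.
Qed.

(** * Coded vectors *)

Fixpoint down pi K n (v : pi) : pi :=
  if n is n'.+1 then lower (K n') (down K n' v) else v.
Definition up pi w (v : pi) : pi := foldr (fun i u => raise i u) v w.
(** The vector lies in the range of s_(K 0) ... s_(K n) for every [n]. For a
    vector of a permutative basis [K] is its itinerary. *)
Definition coded pi K (v : pi) : Prop :=
  forall n, raise (K n) (down K n.+1 v) = down K n v.

Lemma down_linear pi K n : linear (down K n : pi -> pi).
Proof. by elim: n => [|n IH] a u v //=; rewrite IH lower_linear. Qed.
Lemma up_linear pi w : linear (up w : pi -> pi).
Proof. by elim: w => [|i w IH] a u v //=; rewrite IH raise_linear. Qed.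
Lemma downZ pi K n a (v : pi) : down K n (a *: v) = a *: down K n v.
Proof. by rewrite (linear_Z (down_linear K n)). Qed.
Lemma upZ pi w a (v : pi) : up w (a *: v) = a *: up w v.
Proof. by rewrite (linear_Z (up_linear w)). Qed.
Lemma up_cat pi w w' (v : pi) : up (w ++ w') v = up w (up w' v).
Proof. by rewrite /up foldr_cat. Qed.

Lemma down_add pi K m n (v : pi) : down K (m + n) v = down (shift m K) n (down K m v).
Proof. by elim: n => [|n IH]; rewrite ?addn0 // addnS /= IH. Qed.
Lemma downS pi K n (v : pi) : down K n.+1 v = down (shift 1 K) n (lower (K 0%N) v).
Proof. by rewrite -addn1 addnC down_add. Qed.

Lemma coded_comb pi K a (u v : pi) : coded K u -> coded K v -> coded K (a *: u + v).
Proof. by move=> cu cv n; rewrite !down_linear raise_linear cu cv. Qed.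
Lemma coded0 pi K : coded K (0 : pi).
Proof. by move=> n; rewrite !(linear_0 (down_linear _ _)) raise0. Qed.
Lemma codedZ pi K a (v : pi) : coded K v -> coded K (a *: v).
Proof.
by move=> cv; rewrite -[_ *: _]addr0; apply: coded_comb => //; exact: coded0.
Qed.
Lemma coded_sum pi K (I : Type) (r : seq I) (F : I -> pi) :
  (forall i, coded K (F i)) -> coded K (\sum_(i <- r) F i).
Proof.
move=> cF; elim/big_ind: _ => // [|u v cu cv]; first exact: coded0.
by rewrite -[u]scale1r; exact: coded_comb.
Qed.

Lemma coded_head pi K (v : pi) : coded K v -> raise (K 0%N) (lower (K 0%N) v) = v.
Proof. by move=> /(_ 0%N). Qed.

Lemma coded_down pi K n (v : pi) : coded K v -> coded (shift n K) (down K n v).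
Proof. by move=> cv k; rewrite -!down_add addnS; exact: cv. Qed.

Lemma lower_coded_neq pi K i (v : pi) : coded K v -> i != K 0%N -> lower i v = 0.
Proof. by move=> /coded_head <- iK; exact: lower_raise_neq. Qed.

Lemma coded_dot1 pi K (u v : pi) : coded K v ->
  '[lower (K 0%N) u, lower (K 0%N) v] = '[u, v].
Proof. by move=> cv; rewrite dot_lower coded_head. Qed.

Lemma coded_dot pi K n (u v : pi) : coded K v -> '[down K n u, down K n v] = '[u, v].
Proof.
move=> cv; elim: n => //= n IH; rewrite -IH dot_lower.
by have := cv n; rewrite /= => ->.
Qed.

Lemma coded_norm pi K n (v : pi) : coded K v -> `|down K n v| = `|v|.
Proof. by move=> cv; apply/eqP; rewrite -(@eqrXn2 _ 2%N) // -!dotuu coded_dot. Qed.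

(** Remove the common prefix, which preserves inner products: then the first
    letters differ. *)
Lemma coded_ortho pi K L (u v : pi) : coded K u -> coded L v -> K <> L -> '[u, v] = 0.
Proof.
move=> cu cv KL; have [n] : exists n, K n <> L n.
  by apply/existsNP => h; apply: KL; apply/funext.
elim: n K L u v cu cv {KL} => [|n IH] K L u v cu cv KLn.
  rewrite -(coded_head cu) -(coded_head cv) dot_raise_neq //.
  exact/eqP.
have [e|/eqP ne] := pselect (K 0%N = L 0%N); last first.
  by rewrite -(coded_head cu) -(coded_head cv) dot_raise_neq.
rewrite -(coded_dot1 _ cv) -e; apply: (IH (shift 1 K) (shift 1 L)) KLn.
  exact: (coded_down 1).
by rewrite e; exact: (coded_down 1).
Qed.

Lemma coded_uniq pi K L (v : pi) : coded K v -> coded L v -> v <> 0 -> K = L.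
Proof.
move=> cK cL v0; apply: contrapT => KL.
by apply/v0/dot_uu0; exact: coded_ortho KL.
Qed.

Lemma lower_raise_coded pi K i (v : pi) : coded K v ->
  lower i (raise i v) = (A i (K 0%N))%:R *: v.
Proof. by move=> cv; apply: lower_raise_in; exact: coded_head. Qed.

Lemma coded_raise pi K i (v : pi) : coded K v -> A i (K 0%N) ->
  coded (cons_seq i K) (raise i v) /\
  forall n, down (cons_seq i K) n.+1 (raise i v) = down K n v.
Proof.
move=> cv AiK; have lr : lower i (raise i v) = v.
  by rewrite (lower_raise_coded _ cv) AiK scale1r.
have dn n : down (cons_seq i K) n.+1 (raise i v) = down K n v.
  by rewrite downS /= lr.
by split=> // -[|n]; [rewrite dn|rewrite !dn; exact: cv].
Qed.

Lemma raise_coded0 pi K i (v : pi) : coded K v -> ~~ A i (K 0%N) -> raise i v = 0.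
Proof.
by move=> cv /negbTE h; apply: raise_eq0; rewrite (lower_raise_coded _ cv) h scale0r.
Qed.

(** Prepending a word either meets a forbidden transition and gives zero, or
    is undone by [down]. *)
Lemma coded_up pi K w (v : pi) : coded K v ->
  up w v = 0 \/ exists2 L, shift (size w) L = K & coded L (up w v) /\
    forall n, down L (size w + n) (up w v) = down K n v.
Proof.
move=> cv; elim: w => [|i w [IH|[L LK [cL dL]]]]; first by right; exists K.
  by left; rewrite /= IH raise0.
have [Ai|Ai] := boolP (A i (L 0%N)); last by left; exact: raise_coded0 cL Ai.
have [cL' dL'] := coded_raise cL Ai; right; exists (cons_seq i L).
  by rewrite -LK.
by split => // n; rewrite /= -[RHS]dL -dL'.
Qed.

Lemma coded_admissible pi K (v : pi) : coded K v -> v <> 0 -> admissible_sequence A K.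
Proof.
move=> cv v0 n; apply: contraT => nA.
have c1 := coded_down n.+1 cv; have := cv n.
rewrite (raise_coded0 c1) => [/esym d0|]; last by rewrite /shift addn0.
exfalso; apply/v0/eqP; rewrite -normr_eq0 -(coded_norm n cv) d0 normr_eq0.
exact: eqxx.
Qed.

Lemma up_down pi K n (v : pi) : coded K v -> up (mkseq K n) (down K n v) = v.
Proof.
move=> cv; elim: n => // n IH.
rewrite /mkseq -addn1 iotaD map_cat up_cat addn1 add0n.
by have /= -> := cv n.
Qed.

(** * The cyclic subspace of a coded vector *)

(** The first letter of [up w v] is that of [w], or that of the code when [w]
    is empty. *)
Lemma up_head pi K w (v : pi) : coded K v ->
  raise (head (K 0%N) w) (lower (head (K 0%N) w) (up w v)) = up w v.
Proof. by case: w => [|i w] cv; [exact: coded_head|exact: raiseK]. Qed.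

Lemma lower_down pi K i n (v : pi) : coded K v ->
  lower i (down K n v) = if i == K n then down K n.+1 v else 0.
Proof.
move=> cv; have [->//|ne] := eqVneq i (K n).
by rewrite (lower_coded_neq (coded_down n cv)) // /shift addn0.
Qed.

Lemma lower_up pi K i j w n (v : pi) : coded K v ->
  lower i (raise j (up w (down K n v))) =
  if i == j then (A i (head (K n) w))%:R *: up w (down K n v) else 0.
Proof.
move=> cv; have [<-|ij] := eqVneq i j; last exact: lower_raise_neq.
have := up_head w (coded_down n cv); rewrite /shift addn0 => h.
exact: lower_raise_in.
Qed.

(** The right hand side is reducing: [lower] undoes the last letter prepended,
    up to the factor zero or one given by the matrix, or removes one more letter
    of the code. *)
Lemma cyc_coded pi K (v : pi) : coded K v ->
  cyc v = clspan (fun p : seq 'I_N * nat => up p.1 (down K p.2 v)).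
Proof.
move=> cv; set e := (fun p => _); apply/seteqP; split; last first.
  apply: clspan_min; first exact: cyc_closed.
  move=> [w n]; rewrite /e /=; elim: w => /= [|i w IH]; last exact: cyc_op.
  by elim: n => [|n IH] /=; [exact: cyc_refl|exact: cyc_op].
apply: (cyc_min hO); last exact: (@clspan_mem _ _ _ e ([::], 0%N)).
have cE := clspan_closed e; have E0 : clspan e 0 by case: cE.
split=> // i u eu; split.
  have cR : closed_subspace (raise i @^-1` clspan e).
    apply: preimage_closed_subspace cE; first exact: raise_linear.
    exact: rep_op_continuous.
  apply: (clspan_min cR) eu => -[w n].
  exact: (@clspan_mem _ _ _ e (i :: w, n)).
have cL : closed_subspace (lower i @^-1` clspan e).
  apply: preimage_closed_subspace cE; first exact: lower_linear.
  exact: rep_op_continuous.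
apply: (clspan_min cL) eu => -[[|j w] n]; rewrite /e /=.
  rewrite (lower_down i n cv); case: eqP => // _.
  exact: (@clspan_mem _ _ _ e ([::], n.+1)).
rewrite (lower_up i j w n cv); case: eqP => // _; apply: (closed_subspaceZ _ cE).
exact: (@clspan_mem _ _ _ e (w, n)).
Qed.

Lemma down_extend pi K m d w (v : pi) : coded K v ->
  up w (down K m v) = up (w ++ mkseq (shift m K) d) (down K (m + d) v).
Proof. by move=> cv; rewrite up_cat down_add up_down //; exact: coded_down. Qed.

(** Removing further letters of the code makes the two words equally long; then
    equal first letters cancel, up to a factor given by the matrix, and
    different ones give zero. *)
Lemma coded_gram pi rho K (v : pi) (v' : rho) : coded K v -> coded K v' ->
  (forall m n, '[down K m v, down K n v] = '[down K m v', down K n v']) ->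
  forall w m w' m', '[up w (down K m v), up w' (down K m' v)]
                  = '[up w (down K m v'), up w' (down K m' v')].
Proof.
move=> cv cv' vv' w m w' m'.
pose d := (size w' - size w)%N; pose d' := (size w - size w')%N.
rewrite !(down_extend m d w) // !(down_extend m' d' w') //.
have : size (w ++ mkseq (shift m K) d) = size (w' ++ mkseq (shift m' K) d').
  by rewrite !size_cat !size_mkseq /d /d' -!maxnE maxnC.
move: (m + d)%N (m' + d')%N (w ++ _) (w' ++ _) => {m m' d d'}m m' {}w {}w'.
elim: w w' => [|i w IH] [|j w'] //= [ww'].
have [<-|ij] := eqVneq i j; last by rewrite !dot_raise_neq.
rewrite !dot_raise.
rewrite (lower_raise_in _ (up_head w' (coded_down m' cv))).
rewrite (lower_raise_in _ (up_head w' (coded_down m' cv'))).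
by rewrite !dotZr IH.
Qed.

(** The unitary matching the two total families intertwines the generators,
    which act on both families by the same formulas. *)
Lemma coded_equivalent pi rho K (v : pi) (v' : rho) : coded K v -> coded K v' ->
  cyclic_vector v -> cyclic_vector v' ->
  (forall m n, '[down K m v, down K n v] = '[down K m v', down K n v']) ->
  unitarily_equivalent pi rho.
Proof.
move=> cv cv' vtot vtot' vv'.
pose e (sigma : representation O) (u : sigma) (p : seq 'I_N * nat) :=
  up p.1 (down K p.2 u).
have etot : clspan (e _ v) = [set: pi] by rewrite /e -cyc_coded.
have etot' : clspan (e _ v') = [set: rho] by rewrite /e -cyc_coded.
have [|U [linU bijU dU Ue]] := gram_unitary etot etot'.
  by move=> [w m] [w' m']; exact: coded_gram.
exists U; split => //; apply: (intertwiner hO) => //.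
move=> i u; apply: (total_ext etot') => -[w n].
rewrite -dot_lower -[in LHS]Ue dU -dot_lower -[LHS]dU; congr '[_, _].
rewrite /e; case: w => [|j w] /=.
  rewrite (lower_down i n cv) (lower_down i n cv').
  by case: ifP => _; [exact: (Ue ([::], n.+1))|rewrite (linear_0 linU)].
rewrite (lower_up i j w n cv) (lower_up i j w n cv'); case: ifP => _.
  by rewrite (linear_Z linU); congr (_ *: _); exact: (Ue (w, n)).
by rewrite (linear_0 linU).
Qed.

End Coded.

(** * Generating vectors of the cyclic classes *)

Section Standard.
Variables (R : realType) (N : nat) (A : 'M[bool]_N).
Variables (O : cstarAlgType R) (s : 'I_N -> O).
Hypothesis hO : is_cuntz_krieger A s.
Implicit Types pi rho : representation O.
Implicit Types (K L : nat -> 'I_N) (w : seq 'I_N).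
Local Notation raise := (raise s).
Local Notation lower := (lower s).
Local Notation down := (down s).
Local Notation up := (up s).
Local Notation coded := (coded s).

Definition tail_std pi K (v : pi) : Prop :=
  [/\ `|v| = 1, coded K v &
      forall m n, m <> n -> '[down K m v, down K n v] = 0].

(** For [K] the repetition of a word [J] of length [p], this is the equation
    s_J v = c v read backwards. *)
Definition cycle_std pi K p (c : R[i]) (v : pi) : Prop :=
  [/\ `|v| = 1, coded K v & down K p v = c^-1 *: v].

Lemma raise_lower_norm pi i (v : pi) : `|lower i v| = `|v| -> raise i (lower i v) = v.
Proof.
move=> nv; set p := raise i (lower i v).
have pv : '[p, v] = '[v, v] by rewrite /p dot_raise !dotuu nv.
have pp : '[p, p] = '[p, v].
  by rewrite /p !dot_raise (lowerK hO).
apply/eqP; rewrite -subr_eq0; apply/eqP/dot_uu0.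
rewrite dotBl !dotBr pp [in '[v, p]]dotC pv dotuu.
by rewrite conj_Creal ?subrr ?rpredX ?normr_real.
Qed.

(** * Infinite words *)

Lemma rep_op_lowers pi K n (v : pi) :
  rep_op (\prod_(l < n) star (s (K (n.-1 - l)%N))) v = down K n v.
Proof.
elim: n => [|n IH]; first by rewrite big_ord0 rep_op1.
rewrite big_ord_recl rep_opM /= subn0 -IH; congr (rep_op _ (rep_op _ _)).
by apply: eq_bigr => l _; rewrite /bump /=; congr (star (s (K _))); lia.
Qed.

(** All the vectors obtained from [v] by removing letters have norm one, so
    nothing is lost on the way. The orthonormal family starts after the first
    letter; that [v] is orthogonal to the others follows by removing one more
    letter from both. *)
Lemma P_sequence_std pi K : is_P_sequence s pi K ->
  exists2 v : pi, tail_std K v & cyclic_vector v.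
Proof.
move=> [v [v1 vcyc [e1 eo]]]; exists v => //.
have n1 n : `|down K n v| = 1.
  by case: n => [//|n]; rewrite -rep_op_lowers; exact: e1.
have ort m n : m <> n -> '[down K m.+1 v, down K n.+1 v] = 0.
  by move=> mn; rewrite -!rep_op_lowers; exact: eo.
have cv : coded K v.
  by move=> n; apply: raise_lower_norm; rewrite -[lower _ _]/(down K n.+1 v) !n1.
have ort0 n : '[down K n.+1 v, v] = 0.
  rewrite -[X in '[_, X]](coded_head cv) -dot_lower (lower_down hO _ _ cv).
  by case: ifP => _; [exact: (ort n.+1 0%N)|exact: dot0l].
split => // -[|m] [|n] // mn; first by apply: dot_sym0; exact: ort0.
by apply: ort => e; apply: mn; rewrite e.
Qed.

Lemma std_P_sequence pi K (v : pi) : tail_std K v -> cyclic_vector v ->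
  is_P_sequence s pi K.
Proof.
move=> [v1 cv ort] vcyc; exists v; split=> //; split=> [n|m n mn].
  by rewrite (rep_op_lowers K n.+1) (coded_norm _ cv).
rewrite (rep_op_lowers K m.+1) (rep_op_lowers K n.+1).
by apply: ort => -[].
Qed.

Lemma tail_std_down pi K n (v : pi) : tail_std K v -> tail_std (shift n K) (down K n v).
Proof.
move=> [v1 cv ort]; split; first by rewrite (coded_norm _ cv).
  exact: coded_down.
by move=> m k mk; rewrite -!down_add; apply: ort => /addnI.
Qed.

Lemma tail_std_raise pi K i (v : pi) : tail_std K v -> A i (K 0%N) ->
  tail_std (cons_seq i K) (raise i v).
Proof.
move=> [v1 cv ort] AiK; have [cv' dv'] := coded_raise hO cv AiK.
have ort0 n : '[raise i v, down (cons_seq i K) n.+1 (raise i v)] = 0.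
  rewrite dv'; have [e|ne] := eqVneq i (K n); last first.
    by rewrite -(cv n) (dot_raise_neq hO).
  by rewrite dot_raise e; exact: (ort 0%N n.+1).
split=> //; first by have := dv' 0%N => /= h; rewrite -(coded_norm 1 cv') /= h.
move=> [|m] [|n] // mn; first by apply: dot_sym0; exact: ort0.
by rewrite !dv'; apply: ort => e; apply: mn; rewrite e.
Qed.

Lemma cyc_down pi K n (v : pi) : coded K v -> cyc (down K n v) = cyc v.
Proof.
move=> cv; apply: (cyc_eq hO).
  by elim: n => [|n IH]; [exact: cyc_refl|exact: cyc_op].
rewrite -{2}(up_down n cv); elim: (mkseq K n) => [|i w IH]; first exact: cyc_refl.
exact: cyc_op.
Qed.

(** Removing letters, or prepending letters allowed by the matrix, keeps a
    generating vector of an infinite word and its cyclic subspace. *)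
Lemma tail_std_transport pi K L a b (v : pi) : admissible_sequence A L ->
  shift a K = shift b L -> tail_std K v ->
  exists2 v' : pi, tail_std L v' & cyc v' = cyc v.
Proof.
move=> admL KL stdv; have [_ cv _] := stdv.
have : exists2 v' : pi, tail_std (shift b L) v' & cyc v' = cyc v.
  exists (down K a v); last exact: cyc_down.
  by rewrite -KL; exact: tail_std_down.
elim: b {KL} => // b IH [v' std' cyc']; apply: IH.
have [_ cv' _] := std'.
have AL : A (L b) (shift b.+1 L 0%N) by rewrite /shift addn0.
exists (raise (L b) v'); first by rewrite -cons_shift; exact: tail_std_raise.
have [cr dr] := coded_raise hO cv' AL.
by rewrite -cyc' -(cyc_down 1 cr) dr.
Qed.

(** * Finite words *)

Lemma rep_op_raises pi w (v : pi) : rep_op (\prod_(j <- w) s j) v = up w v.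
Proof.
elim: w => [|i w IH]; first by rewrite big_nil rep_op1.
by rewrite big_cons rep_opM IH.
Qed.

Variable x0 : 'I_N.

Lemma cycle_down pi K p c (v : pi) n : shift p K = K -> cycle_std K p c v ->
  down K (p + n) v = c^-1 *: down K n v.
Proof. by move=> pK [_ _ dv]; rewrite down_add pK dv downZ. Qed.

Lemma cycle_down_iter pi K p c (v : pi) n : shift p K = K -> cycle_std K p c v ->
  down K n v = c^-1 ^+ (n %/ p) *: down K (n %% p) v.
Proof.
move=> pK sv; rewrite {1}(divn_eq n p); elim: (n %/ p)%N => [|k IH].
  by rewrite mul0n expr0 scale1r.
by rewrite mulSn -addnA (cycle_down _ pK sv) IH scalerA exprS.
Qed.

(** Within one period the codes are different shifts of [K], hence orthogonal;
    every full period contributes a factor. *)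
Lemma cycle_gram pi K p c (v : pi) m n : primitive_period K p -> `|c| = 1 ->
  cycle_std K p c v -> '[down K m v, down K n v] =
  c^-1 ^+ (m %/ p) * Num.conj (c^-1 ^+ (n %/ p)) * (m %% p == n %% p)%N%:R.
Proof.
move=> prim c1 sv; have [p0 pK _] := prim; have [v1 cv _] := sv.
rewrite (cycle_down_iter m pK sv) (cycle_down_iter n pK sv) dotZl dotZr mulrA.
congr (_ * _); have [e|ne] := eqVneq (m %% p)%N (n %% p)%N.
  by rewrite e (coded_dot _ _ cv) dotuu v1 expr1n.
apply: (coded_ortho hO (coded_down _ cv) (coded_down _ cv)) => /primitive_inj.
by move=> /(_ _ prim (ltn_pmod _ p0) (ltn_pmod _ p0)) /eqP; rewrite (negbTE ne).
Qed.

(** The vectors s_{j_l} ... s_{j_p} v all have norm one, so each is carried to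
    the next by removing a letter: the word is the beginning of the code, and
    the equation for [v] makes the code periodic. *)
Lemma P_cycle_std pi J c : J != [::] -> `|c| = 1 -> is_P_cycle s pi J c ->
  exists2 v : pi, cycle_std (repeat_word x0 J) (size J) c v & cyclic_vector v.
Proof.
rewrite -size_eq0 -lt0n => J0 c1 [v [v1 vcyc Jv [e1 _]]]; exists v => //.
set p := size J in J0 *; set K := repeat_word x0 J.
pose x l := up (drop l J) v.
have xp : x p = v by rewrite /x drop_size.
have x0E : x 0%N = c *: v by rewrite /x drop0 -rep_op_raises.
have x1 l : (l <= p)%N -> `|x l| = 1.
  rewrite leq_eqVlt => /predU1P[->|lp]; first by rewrite xp.
  by have := e1 (Ordinal lp); rewrite rep_op_raises.
have xS l : (l < p)%N -> x l = raise (K l) (x l.+1).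
  by move=> lp; rewrite /x (drop_nth x0 lp) /= /K /repeat_word modn_small.
have lx l : (l < p)%N -> lower (K l) (x l) = x l.+1.
  move=> lp; rewrite xS //; apply: (lower_raise_norm hO).
  by rewrite -xS // !x1 // ltnW.
have dx l : (l <= p)%N -> down K l v = c^-1 *: x l.
  elim: l => [_|l IH lp]; first by rewrite x0E scalerA mulVf ?scale1r // unit_neq0.
  by rewrite /= IH 1?ltnW // lowerZ lx.
have pK : shift p K = K by exact: (repeat_word_period x0).
have dp : down K p v = c^-1 *: v by rewrite dx // xp.
split=> // n; elim/ltn_ind: n => n IH.
have [np|pn] := ltnP n p; first by rewrite !dx // 1?ltnW // raiseZ -xS.
rewrite -(subnKC pn) -addnS !down_add pK dp !downZ raiseZ.
have -> : K (p + (n - p))%N = K (n - p)%N by rewrite -[in RHS]pK.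
by rewrite IH // ltn_subrL J0 (leq_trans J0).
Qed.

Lemma std_P_cycle pi K p c (v : pi) : (0 < p)%N -> shift p K = K -> `|c| = 1 ->
  (forall m n, (m < p)%N -> (n < p)%N -> m <> n -> '[down K m v, down K n v] = 0) ->
  cycle_std K p c v -> cyclic_vector v -> is_P_cycle s pi (mkseq K p) c.
Proof.
move=> p0 pK c1 ort sv vcyc; have [v1 cv dv] := sv.
have c0 := unit_neq0 c1.
have upE l : (l <= p)%N -> up (drop l (mkseq K p)) v = c *: down K l v.
  move=> lp; rewrite -[v in LHS](scalerKV c0) -dv upZ; congr (_ *: _).
  rewrite -(subnKC lp) down_add (subnKC lp) -map_drop drop_iota add0n.
  rewrite (_ : map K _ = mkseq (shift l K) (p - l)); last first.
    by rewrite /mkseq -[X in iota X _](addn0 l) iotaDl -map_comp.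
  by rewrite up_down //; exact: coded_down.
exists v; split=> //; first by rewrite rep_op_raises -[mkseq _ _]drop0 upE.
split=> [l|l l' ll']; rewrite !rep_op_raises.
  rewrite upE; last by rewrite ltnW // -[ltnRHS](size_mkseq K p).
  by rewrite normrZ c1 mul1r (coded_norm _ cv).
have lp (k : 'I_(size (mkseq K p))) : (k < p)%N by rewrite -[ltnRHS](size_mkseq K p).
rewrite !upE; [|exact: ltnW..].
rewrite dotZl dotZr ort ?mulr0 // => /val_inj; exact: ll'.
Qed.

(** * Disjointness *)

(** Prepending letters to both vectors can be undone on both sides at once, so
    only the vectors obtained by removing letters matter. *)
Lemma cyc_ortho pi K L (u v : pi) : coded K u -> coded L v ->
  (forall a b, shift a K = shift b L -> '[down K a u, down L b v] = 0) ->
  forall x y, cyc u x -> cyc v y -> '[x, y] = 0.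
Proof.
move=> cu cv h x y; rewrite (cyc_coded hO cu) (cyc_coded hO cv).
apply: clspan_ortho2 => -[w m] [w' n] /=.
have [->|[L1 L1K [cL1 dL1]]] := coded_up hO w (coded_down m cu).
  by rewrite dot0l.
have [->|[L2 L2K [cL2 dL2]]] := coded_up hO w' (coded_down n cv).
  by rewrite dot0r.
have [e|ne] := pselect (L1 = L2); last exact: (coded_ortho hO cL1 cL2 ne).
rewrite -{}e in L2K cL2 dL2.
rewrite -(coded_dot (size w + size w') _ cL2) dL1 addnC dL2 -!down_add.
apply: h; rewrite -[(m + _)%N]/(m + size w')%N.
by rewrite -!shift_shift -L1K -L2K !shift_shift addnC.
Qed.

(** Removing whole periods multiplies one vector by phases and carries the
    other through an orthonormal sequence, which contradicts Bessel unless the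
    inner product vanishes. *)
Lemma tail_cycle_ortho pi K L p c (u v : pi) : tail_std K u -> (0 < p)%N ->
  shift p L = L -> `|c| = 1 -> cycle_std L p c v ->
  forall a b, shift a K = shift b L -> '[down K a u, down L b v] = 0.
Proof.
move=> su p0 pL c1 sv a b ab.
have [_ cx ox] := tail_std_down a su; set x := down K a u in cx ox *.
have [_ cv dv] := sv; have := coded_down b cv; set y := down L b v => cy.
rewrite ab in cx ox; set M := shift b L in cx cy ox.
have pM : shift p M = M by rewrite /M shift_shift addnC -shift_shift pL.
have dy : down M p y = c^-1 *: y.
  by rewrite /M /y -down_add addnC (cycle_down _ pL sv).
have dyk k : down M (k * p) y = c^-1 ^+ k *: y.
  elim: k => [|k IH]; first by rewrite expr0 scale1r.
  by rewrite mulSn down_add pM dy downZ IH scalerA exprS.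
have [x1 _ _] := tail_std_down a su.
apply/dot_sym0/eqP; rewrite -normr_eq0; apply/eqP.
apply: (@bessel_constant _ _ (fun k => down M (k * p) x) y).
- by move=> k; rewrite (coded_norm _ cx).
- by move=> k l kl; apply: ox => /eqP; rewrite eqn_pmul2r // => /eqP.
- move=> k; rewrite -(coded_dot (k * p) y cx) dyk dotZl normrM normrX normfV c1.
  by rewrite invr1 expr1n mul1r.
Qed.

(** Removing one period from both vectors preserves their inner product and
    multiplies it by [c' / c]. *)
Lemma cycle_phase_ortho pi K p c c' (u v : pi) : shift p K = K ->
  `|c| = 1 -> `|c'| = 1 -> c != c' -> cycle_std K p c u -> cycle_std K p c' v ->
  forall a b, shift a K = shift b K -> '[down K a u, down K b v] = 0.
Proof.
move=> pK c1 c1' cc' su sv a b ab.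
have [_ /(coded_down b) cv dv] := sv; have [_ cu du] := su.
have pM : shift p (shift b K) = shift b K.
  by rewrite shift_shift addnC -shift_shift pK.
have := coded_dot p (down K a u) cv.
rewrite -{1}ab -!down_add ![(_ + p)%N]addnC.
rewrite (cycle_down _ pK su) (cycle_down _ pK sv) dotZl dotZr mulrA.
rewrite -(conj_unit c1') conjCK => /eqP; rewrite -subr_eq0 -{2}['[_, _]]mul1r -mulrBl.
rewrite mulf_eq0 subr_eq0 => /orP[|/eqP//] /eqP e.
by case/eqP: cc'; rewrite -[c]mulr1 -e mulrA divff ?mul1r // unit_neq0.
Qed.

End Standard.

(** * Labels *)

Lemma sval_inj T (P : T -> Prop) : injective (@sval T P).
Proof.
move=> [x Px] [y Py] /= xy; case: _ / xy in Py *.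
by rewrite (Prop_irrelevance Px Py).
Qed.

Section Labels.
Variables (R : realType) (N : nat) (A : 'M[bool]_N).
Variables (O : cstarAlgType R) (s : 'I_N -> O).
Hypothesis hO : is_cuntz_krieger A s.
Variable x0 : 'I_N.
Implicit Types pi rho : representation O.
Implicit Types (K L : nat -> 'I_N) (w : seq 'I_N) (l : label R A).
Local Notation raise := (raise s).
Local Notation lower := (lower s).
Local Notation down := (down s).
Local Notation up := (up s).
Local Notation coded := (coded s).

(** Representatives of a tail class generate the same class of representations,
    so one of them is fixed for each label. *)
Definition code l : nat -> 'I_N :=
  match l with
  | inl (J, c) => repeat_word x0 (sval J)
  | inr k => s2val (cid2 (svalP k))
  end.

Definition std pi l (v : pi) : Prop :=
  match l with
  | inl (J, c) => cycle_std s (code l) (size (sval J)) (sval c) v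
  | inr k => tail_std s (code l) v
  end.

Lemma tail_code (k : tail_label A) :
  admissible_sequence A (code (inr k)) /\ sval k = tail_class A (code (inr k)).
Proof. by rewrite /=; case: cid2. Qed.

Lemma cycle_label_nonempty (J : cycle_label A) : sval J != [::].
Proof. by have [/andP[]] := svalP J. Qed.

Lemma cycle_label_primitive (J : cycle_label A) :
  primitive_period (repeat_word x0 (sval J)) (size (sval J)).
Proof.
have [_ _ nJ] := svalP J; apply: nonperiodic_primitive => //.
exact: cycle_label_nonempty.
Qed.

Lemma unit_circle_norm (c : unit_circle R) : `|sval c| = 1.
Proof. exact/eqP/(svalP c). Qed.

Lemma std_norm pi l (v : pi) : std l v -> `|v| = 1.
Proof. by case: l => [[J c]|k] []. Qed.
Lemma std_coded pi l (v : pi) : std l v -> coded (code l) v.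
Proof. by case: l => [[J c]|k] []. Qed.
Lemma std_neq0 pi l (v : pi) : std l v -> v <> 0.
Proof.
by move=> /std_norm v1 v0; have /eqP := v1; rewrite v0 normr0 eq_sym oner_eq0.
Qed.

Lemma in_class_std pi l : in_class s l pi -> exists2 v : pi, std l v & cyclic_vector v.
Proof.
case: l => [[J c]|k] /=.
  apply: (P_cycle_std hO x0); first exact: cycle_label_nonempty.
  exact: unit_circle_norm.
have [admK kE] := tail_code k; move=> [L].
rewrite {1}kE => -[_ /tail_equivalentP[a [b ab]]] /(P_sequence_std hO)[v sv vcyc].
have [v' sv' cyc'] := tail_std_transport hO admK (esym ab) sv.
by exists v' => //; rewrite /cyclic_vector -/(cyc v') cyc'.
Qed.

Lemma std_in_class pi l (v : pi) : std l v -> cyclic_vector v -> in_class s l pi.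
Proof.
case: l => [[J c]|k] /= sv vcyc; last first.
  have [admK kE] := tail_code k; exists (code (inr k)); last exact: std_P_sequence vcyc.
  by rewrite kE; exact: tail_class_mem.
have prim := cycle_label_primitive J; have [p0 pK _] := prim.
have [_ cv _] := sv.
rewrite -(mkseq_repeat_word x0 (sval J)).
apply: (std_P_cycle p0 pK (unit_circle_norm c) _ sv vcyc) => m n mp np mn.
apply: (coded_ortho hO (coded_down m cv) (coded_down n cv)).
by move=> /(primitive_inj prim mp np).
Qed.

Lemma std_equivalent pi rho l (v : pi) (v' : rho) : std l v -> std l v' ->
  cyclic_vector v -> cyclic_vector v' -> unitarily_equivalent pi rho.
Proof.
move=> sv sv' vcyc vcyc'.
apply: (coded_equivalent hO (std_coded sv) (std_coded sv') vcyc vcyc') => m n.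
case: l sv sv' => [[J c]|k] sv sv'.
  have prim := cycle_label_primitive J; have c1 := unit_circle_norm c.
  by rewrite (cycle_gram hO _ _ prim c1 sv) (cycle_gram hO _ _ prim c1 sv').
have [v1 cv ov] := sv; have [v1' cv' ov'] := sv'.
have [->|/eqP mn] := eqVneq m n; last by rewrite ov // ov'.
by rewrite !dotuu (coded_norm _ cv) (coded_norm _ cv') v1 v1'.
Qed.

Lemma std_disjoint pi l l' (u v : pi) : std l u -> std l' v -> l <> l' ->
  forall x y, cyc u x -> cyc v y -> '[x, y] = 0.
Proof.
move=> su sv ll'; apply: (cyc_ortho hO (std_coded su) (std_coded sv)) => a b ab.
case: l l' su sv ll' ab => [[J c]|k] [[J' c']|k'] su sv ll' ab.
- have [JJ'|ne] := eqVneq (sval J) (sval J'); last first.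
    case/eqP: ne; have [_ mJ nJ] := svalP J; have [_ mJ' nJ'] := svalP J'.
    have J0 := cycle_label_nonempty J; have J0' := cycle_label_nonempty J'.
    exact: (cycle_word_uniq J0 J0' mJ mJ' nJ nJ' ab).
  have {}JJ' : J = J' by exact: sval_inj.
  move: su sv ll' ab; rewrite -{J'}JJ' => su sv ll' ab.
  have [_ pK _] := cycle_label_primitive J.
  apply: (cycle_phase_ortho pK _ _ _ su sv) => //; try exact: unit_circle_norm.
  by apply/eqP => cc'; apply: ll'; congr (inl (J, _)); exact: sval_inj.
- have [p0 pK _] := cycle_label_primitive J.
  apply: dot_sym0; apply: (tail_cycle_ortho sv p0 pK _ su) => //.
  exact: unit_circle_norm.
- have [p0 pK _] := cycle_label_primitive J'.
  apply: (tail_cycle_ortho su p0 pK _ sv) => //.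
  exact: unit_circle_norm.
- exfalso; apply: ll'; congr inr; apply: sval_inj.
  have [_ ->] := tail_code k; have [_ ->] := tail_code k'.
  by apply: tail_class_eq; apply/tail_equivalentP; exists a, b.
Qed.

(** * Transport along isometric intertwiners *)

Section Embedding.
Variables (rho pi : representation O) (iota : rho -> pi).
Hypothesis iota_lin : linear iota.
Hypothesis iota_dot : forall u v, '[iota u, iota v] = '[u, v].
Hypothesis iota_op : forall x v, iota (rep_op x v) = rep_op x (iota v).

Lemma iota_inj : injective iota.
Proof.
move=> u v uv; apply/eqP; rewrite -subr_eq0 -normr_eq0.
by rewrite -(isometry_norm iota_dot) (linear_B iota_lin) uv subrr normr0.
Qed.

Lemma down_embed K n v : down K n (iota v) = iota (down K n v).
Proof. by elim: n => //= n ->; rewrite /lower iota_op. Qed.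

Lemma coded_embed K v : coded K (iota v) <-> coded K v.
Proof.
split=> cv n; have := cv n; rewrite !down_embed /raise -iota_op.
  exact: iota_inj.
by move=> h; congr iota.
Qed.

Lemma std_embed l v : std l (iota v) <-> std l v.
Proof.
case: l => [[J c]|k]; split=> -[v1 /coded_embed cv dv].
- split=> //; first by rewrite -(isometry_norm iota_dot).
  by apply: iota_inj; rewrite -down_embed dv (linear_Z iota_lin).
- split=> //; first by rewrite (isometry_norm iota_dot).
  by rewrite down_embed dv (linear_Z iota_lin).
- split=> //; first by rewrite -(isometry_norm iota_dot).
  by move=> m n mn; rewrite -iota_dot -!down_embed; exact: dv.
- split=> //; first by rewrite (isometry_norm iota_dot).
  by move=> m n mn; rewrite !down_embed iota_dot; exact: dv.
Qed.

Lemma cyc_embed_ortho v z : cyclic_vector v ->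
  (forall y, cyc (iota v) y -> '[y, z] = 0) -> forall u, '[iota u, z] = 0.
Proof.
move=> vcyc oz u.
have cP : closed_subspace (iota @^-1` [set y | '[y, z] = 0]).
  apply: preimage_closed_subspace => //; last exact: orthocomplement_closed.
  exact: isometry_continuous (isometry_norm iota_dot).
have : cyc v u by rewrite /cyc vcyc.
rewrite cycE => /(clspan_min cP); apply => x /=; rewrite iota_op.
by apply: oz; apply: cyc_op; exact: cyc_refl.
Qed.

End Embedding.

(** * The vectors with the code of a label *)

(** The pair [(n, m)] stands for removing [m] letters and prepending the first
    [n] letters of the code. This restores the code when the shifts by [n] and
    by [m] agree; the last condition says that no letter is removed only to be
    put back, so that different pairs give different vectors. *)
Definition frame_index l (x : nat * nat) : Prop :=
  match l with
  | inl _ => x = (0%N, 0%N)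
  | inr _ => let K := code l in shift x.1 K = shift x.2 K /\
      [\/ x.1 = 0%N, x.2 = 0%N | K x.1.-1 <> K x.2.-1]
  end.

Definition frame pi l (v : pi) (x : nat * nat) : pi :=
  if `[< frame_index l x >] then up (mkseq (code l) x.1) (down (code l) x.2 v) else 0.

Lemma frame_index_swap l n m : frame_index l (n, m) -> frame_index l (m, n).
Proof.
case: l => [[J c]|k] /= => [[-> ->] //|[nm h]]; split=> //.
by case: h => [h|h|h]; [apply: Or32|apply: Or31|apply: Or33 => e; exact: h].
Qed.

Lemma frame_cyc pi l (v : pi) x : cyc v (frame l v x).
Proof.
rewrite /frame; case: asboolP => _; last by case: (cyc_closed v).
elim: (mkseq _ _) => [|i w IH]; last exact: cyc_op.
by elim: x.2 => [|n IH]; [exact: cyc_refl|exact: cyc_op].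
Qed.

Lemma up_coded pi K n (y : pi) : admissible_sequence A K -> coded (shift n K) y ->
  coded K (up (mkseq K n) y) /\ down K n (up (mkseq K n) y) = y.
Proof.
move=> admK; elim: n y => // n IH y cy.
have AK : A (K n) (shift n.+1 K 0%N) by rewrite /shift addn0.
have [cr dr] := coded_raise hO cy AK; rewrite cons_shift in cr dr.
have [cu du] := IH _ cr; rewrite /mkseq -addn1 iotaD map_cat up_cat /= add0n.
by split=> //; rewrite addn1 /= du -[RHS](dr 0%N) /= /shift addn0.
Qed.

Lemma dot_up_down pi K n (y z : pi) : '[up (mkseq K n) y, z] = '[y, down K n z].
Proof.
elim: n y => // n IH y; rewrite /mkseq -addn1 iotaD map_cat up_cat /= add0n.
by rewrite IH dot_raise addn1.
Qed.

(** The adjoint of removing [m] and prepending [n] letters is the operation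
    with [n] and [m] exchanged. *)
Lemma frame_adjoint pi l (u v : pi) n m :
  '[frame l u (n, m), v] = '[u, frame l v (m, n)].
Proof.
rewrite /frame; case: asboolP => [nm|nm]; case: asboolP => [mn|mn] /=.
- by rewrite dot_up_down [RHS]dotC dot_up_down -dotC.
- by case: mn; exact: frame_index_swap.
- by case: nm; exact: frame_index_swap.
- by rewrite dot0l dot0r.
Qed.

Lemma std_admissible pi l (v : pi) : std l v -> admissible_sequence A (code l).
Proof.
move=> sv; apply: (coded_admissible hO (std_coded sv)); exact: (std_neq0 sv).
Qed.

Lemma frame_coded pi l (v : pi) x : std l v -> coded (code l) (frame l v x).
Proof.
move=> sv; rewrite /frame; case: asboolP => [fx|_]; last exact: coded0.
have cv := std_coded sv; have admK := std_admissible sv.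
suff KK : shift x.1 (code l) = shift x.2 (code l).
  have [|//] := @up_coded _ (code l) x.1 (down (code l) x.2 v) admK.
  by rewrite KK; exact: coded_down.
by case: l fx {sv cv admK} => [[J c]|k] /= => [->|[]].
Qed.

Lemma frame_norm pi l (v : pi) x : std l v -> frame l v x = 0 \/ `|frame l v x| = 1.
Proof.
move=> sv; rewrite /frame; case: asboolP => [fx|_]; [right|by left].
have cv := std_coded sv; have admK := std_admissible sv.
have KK : shift x.1 (code l) = shift x.2 (code l).
  by case: l fx {sv cv admK} => [[J c]|k] /= => [->|[]].
have [|cu du] := @up_coded _ (code l) x.1 (down (code l) x.2 v) admK.
  by rewrite KK; exact: coded_down.
by rewrite -(coded_norm x.1 cu) du (coded_norm _ cv) (std_norm sv).
Qed.

(** Bring both vectors to the same number of prepended letters and remove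
    these: what remains are two vectors [down K i v] and [down K j v], and
    [i = j] would let one of the pairs be shortened. *)
Lemma frame_ortho pi l (v : pi) x y : std l v -> x <> y ->
  '[frame l v x, frame l v y] = 0.
Proof.
move=> sv; rewrite /frame; case: asboolP => [fx|_]; last by rewrite dot0l.
case: asboolP => [fy|_]; last by rewrite dot0r.
have admK := std_admissible sv.
case: l sv fx fy admK => [[J c]|k] sv /= fx fy admK xy; first by rewrite fx fy in xy.
have [v1 cv ov] := sv; set K := s2val _ in fx fy admK cv ov *.
wlog le_xy : x y fx fy xy / (x.1 <= y.1)%N => [wl|].
  have [le|/ltnW le] := leqP x.1 y.1; first exact: wl.
  by apply: dot_sym0; apply: wl => // e; apply: xy.
case: x y fx fy xy le_xy => [n m] [n' m'] /= [KK hx] [KK' hy] xy le_n.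
have [|cu du] := @up_coded _ K n (down K m v) admK.
  by rewrite KK; exact: coded_down.
have [|cu' du'] := @up_coded _ K n' (down K m' v) admK.
  by rewrite KK'; exact: coded_down.
rewrite -(coded_dot n' _ cu') du' -(subnKC le_n) down_add du KK -down_add.
apply: ov => e; set d := (n' - n)%N in e.
have n'E : n' = (n + d)%N by rewrite subnKC.
case: d e n'E => [|d] e n'E; first by apply: xy; rewrite n'E -e !addn0.
move: hy; rewrite n'E -e !addnS /= => -[//|//|]; apply.
by have := congr1 (fun L => L d) KK.
Qed.

(** A letter that is removed and put back can be cancelled, and along a cycle
    removing whole periods only changes the phase. *)
Lemma frame_complete pi l (v : pi) w m : std l v ->
  coded (code l) (up w (down (code l) m v)) ->
  exists x a, up w (down (code l) m v) = a *: frame l v x.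
Proof.
move=> sv; set K := code l; set b := up _ _ => cb.
have cv := std_coded sv; rewrite -/K in cv.
have [b0|bn0] := pselect (b = 0).
  by exists (0%N, 0%N), 0; rewrite scale0r.
have [//|[L LK [cL dL]]] := coded_up hO w (coded_down m cv).
have LKe : L = K by exact: (coded_uniq hO cL cb).
rewrite {}LKe in LK cL dL.
have bE : b = up (mkseq K (size w)) (down K m v).
  by have /= <- := dL 0%N; rewrite addn0 up_down.
rewrite bE; move: (size w) LK => n LK; clear b cb bE bn0 cL dL w.
case: l @K sv cv LK => [[J c]|k] K sv cv LK.
  have [_ _ dv] := sv; have prim := cycle_label_primitive J.
  have [p0 pK _] := prim; have c1 := unit_circle_norm c.
  set p := size (sval J) in dv prim p0 pK.
  have nm : (n %% p = m %% p)%N.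
    apply: (primitive_inj prim); rewrite ?ltn_mod //.
    have red k : shift (k %% p) K = shift k K.
      by rewrite [in RHS](divn_eq k p) -shift_shift period_iter.
    by rewrite !red.
  exists (0%N, 0%N), ((sval c)^-1 ^+ (m %/ p) * (sval c) ^+ (n %/ p)).
  rewrite /frame asboolT //= (cycle_down_iter m pK sv) -nm.
  have -> : down K (n %% p) v = (sval c) ^+ (n %/ p) *: down K n v.
    rewrite [in RHS](cycle_down_iter n pK sv) scalerA -exprMn divff ?expr1n ?scale1r //.
    exact: unit_neq0.
  by rewrite scalerA upZ up_down.
elim: n m LK => [|n IH] m LK.
  exists (0%N, m), 1; rewrite scale1r /frame asboolT //=; split=> //.
  exact: Or31.
case: m LK => [|m] LK.
  exists (n.+1, 0%N), 1; rewrite scale1r /frame asboolT //=; split=> //.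
  exact: Or32.
have [e|ne] := pselect (K n = K m); last first.
  exists (n.+1, m.+1), 1; rewrite scale1r /frame asboolT //=; split=> //.
  exact: Or33.
have [|x [a xa]] := IH m; first by rewrite -(cons_shift K n) -(cons_shift K m) LK e.
exists x, a; rewrite -xa /mkseq -addn1 iotaD map_cat up_cat /= add0n e.
by have /= -> := cv m.
Qed.

End Labels.

(** * Decompositions as families of vectors *)

Lemma existT_inj_snd (I : Type) (P : I -> Type) i (a b : P i) :
  existT P i a = existT P i b -> a = b.
Proof.
move=> e; have := projT2_eq e.
by rewrite (Prop_irrelevance (projT1_eq e) erefl).
Qed.

Section Decompositions.
Variables (R : realType) (N : nat) (A : 'M[bool]_N).
Variables (O : cstarAlgType R) (s : 'I_N -> O).
Hypothesis hO : is_cuntz_krieger A s.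
Variable x0 : 'I_N.
Implicit Types pi rho : representation O.
Implicit Types (l : label R A).
Local Notation std := (@std R N A O s x0 _).
Local Notation frame := (@frame R N A O s x0 _).

(** A decomposition seen inside the decomposed space: the summands are the
    cyclic subspaces of the vectors [Om l t]. *)
Definition vector_decomposition pi (nu : label R A -> Type)
    (Om : forall l, nu l -> pi) : Prop :=
  [/\ forall l t, std l (Om l t),
      forall l t l' t', existT nu l t <> existT nu l' t' ->
        forall x y, cyc (Om l t) x -> cyc (Om l' t') y -> '[x, y] = 0
    & forall z, (forall l t y, cyc (Om l t) y -> '[y, z] = 0) -> z = 0].

Lemma decomposition_vector pi nu (rho : forall l, nu l -> representation O) :
  decomposition s pi rho ->
  exists Om : forall l, nu l -> pi, vector_decomposition Om.
Proof.
move=> [inc [sigma [V [Viso Vop Vort Vtot]] [U [linU [U' UK VK] dU Uop]]]].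
pose v l t := s2val (cid2 (in_class_std hO x0 (inc l t))).
have vstd l t : std l (v l t) by rewrite /v; case: cid2.
have vcyc l t : cyclic_vector (v l t) by rewrite /v; case: cid2.
pose iota l t (w : rho l t) : pi := U' (V (existT nu l t) w).
have linU' : linear U'.
  by move=> a x y; apply: (can_inj UK); rewrite linU !VK.
have dU' x y : '[U' x, U' y] = '[x, y] by rewrite -dU !VK.
have linV p : linear (V p) by case: (Viso p).
have dV p x y : '[V p x, V p y] = '[x, y] by case: (Viso p) => _; exact.
have iota_lin l t : linear (@iota l t).
  by move=> a x y; rewrite /iota linV linU'.
have iota_dot l t x y : '[@iota l t x, @iota l t y] = '[x, y].
  by rewrite dU' dV.
have iota_op l t x w : @iota l t (rep_op x w) = rep_op x (@iota l t w).
  by rewrite /iota (Vop (existT nu l t)); apply: (can_inj UK); rewrite Uop !VK.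
exists (fun l t => iota l t (v l t)); split.
- by move=> l t; apply/(std_embed s x0 (iota_lin l t) (iota_dot l t) (iota_op l t)).
- move=> l t l' t' ne x y; rewrite !cycE; apply: clspan_ortho2 => a b.
  rewrite -!iota_op dU'; exact: Vort.
- move=> z oz; rewrite -(UK z).
  suff -> : U z = 0 by rewrite (linear_0 linU').
  apply: (total_ext Vtot) => -[[l t] w] /=.
  rewrite dot0r -(VK (V _ _)) dU.
  have := cyc_embed_ortho (iota_lin l t) (iota_dot l t) (iota_op l t) (vcyc l t).
  by apply; exact: oz.
Qed.

Lemma vector_decomposition_rep pi nu (Om : forall l, nu l -> pi) :
  vector_decomposition Om ->
  decomposition s pi (fun l t => cyc_rep (Om l t)).
Proof.
move=> [stdOm ortOm totOm]; split=> [l t|].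
  apply: (std_in_class hO (v := cyc_vector (Om l t))); last exact: cyc_vector_cyclic.
  apply/(@std_embed _ _ _ _ s x0 _ _ (@cyc_incl _ _ _ (Om l t))) => //.
  exact: stdOm.
exists pi; last first.
  by exists idfun; split => //; exists idfun.
exists (fun p => @cyc_incl _ _ _ (Om (projT1 p) (projT2 p))); split=> //.
- move=> [l t] [l' t'] ne u v /=; apply: ortOm ne _ _ _ _; exact: sub_valP.
- apply/seteqP; split=> // z _.
  pose e (p : {i : {l & nu l} & cyc_rep (Om (projT1 i) (projT2 i))}) : pi :=
    cyc_incl (projT2 p).
  have cE := clspan_closed e; change (clspan e z).
  have [p Mp ort] := orthogonal_projection z cE.
  suff : z - p = 0 by move=> /eqP; rewrite subr_eq0 => /eqP ->.
  apply: totOm => l t y cy; apply: dot_sym0; apply: ort.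
  exact: (@clspan_mem _ _ _ e (existT _ (existT _ l t) (SubspaceVector _ cy))).
Qed.

(** * Uniqueness of the multiplicities *)

Section Coefficients.
Variables (pi : representation O) (nu : label R A -> Type).
Variable Om : forall l, nu l -> pi.
Hypothesis decOm : vector_decomposition Om.

(** The component of [v] orthogonal to the frames is orthogonal to every vector
    of the total families: those of other labels are orthogonal by disjointness,
    those with another code by their code, and the remaining ones are multiples
    of frame vectors. *)
Lemma frame_total l (v : pi) : std l v ->
  clspan (fun p : nu l * (nat * nat) => frame l (Om p.1) p.2) v.
Proof.
move=> sv; set F := fun p => _; have [stdOm ortOm totOm] := decOm.
have cF := clspan_closed F; have [p Mp ort] := orthogonal_projection v cF.
suff /eqP : v - p = 0 by rewrite subr_eq0 => /eqP ->.
apply: totOm => l' t y; rewrite (cyc_coded hO (std_coded (stdOm l' t))).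
apply: clspan_ortho => -[w m] /=; set b := up _ _ _.
have cb : cyc (Om t) b.
  rewrite (cyc_coded hO (std_coded (stdOm l' t))).
  pose g (q : seq 'I_N * nat) := up s q.1 (down s (code x0 l') q.2 (Om t)).
  exact: (@clspan_mem _ _ _ g (w, m)).
have [ll'|ll'] := pselect (l' = l); last first.
  rewrite dotBr (std_disjoint hO (stdOm l' t) sv ll' cb (@cyc_refl _ _ _ v)) sub0r.
  apply/eqP; rewrite oppr_eq0; apply/eqP/dot_sym0; apply: clspan_ortho Mp => -[t' x].
  have ct' := @frame_cyc _ _ _ _ s x0 _ l (Om t') x.
  apply: dot_sym0; apply: (ortOm l' t l t' _ _ _ cb ct') => e.
  by apply: ll'; have := congr1 (@projT1 _ _) e.
case: _ / ll' in sv F cF p Mp ort *.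
have [|[L _ [cL _]]] := coded_up hO w (coded_down m (std_coded (stdOm l' t))).
  by rewrite -/b => ->; rewrite dot0l.
rewrite -/b in cL.
have [e|ne] := pselect (L = code x0 l').
  rewrite e in cL; have [x [a bE]] := frame_complete hO (stdOm l' t) cL.
  apply: dot_sym0; apply: ort; rewrite /b bE; apply: closed_subspaceZ cF _.
  exact: (@clspan_mem _ _ _ F (t, x)).
rewrite dotBr (coded_ortho hO cL (std_coded sv) ne) sub0r.
apply/eqP; rewrite oppr_eq0; apply/eqP/dot_sym0; apply: clspan_ortho Mp => -[t' x].
by apply: dot_sym0; exact: (coded_ortho hO cL (frame_coded hO x (stdOm l' t')) ne).
Qed.

Definition frame_weight l (u v : pi) : \bar R :=
  (\esum_(x in [set: nat * nat]) (complex.Re (`|'[u, frame l v x]| ^+ 2))%:E)%E.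

Lemma frame_weight_ge0 l u v : (0 <= frame_weight l u v)%E.
Proof.
apply: esum_ge0 => x _.
by rewrite lee_fin -lecR RRe_real ?rpredX ?normr_real // exprn_ge0.
Qed.

(** Moving the operations to the other side exchanges the two vectors and
    permutes the index set. *)
Lemma frame_weightC l u v : frame_weight l u v = frame_weight l v u.
Proof.
rewrite /frame_weight.
rewrite (@reindex_esum _ _ _ setT setT (fun x : nat * nat => (x.2, x.1))); last first.
  split=> // [[n m] [n' m'] _ _ [-> ->] //|[n m] _].
  by exists (m, n).
apply: eq_esum => -[n m] _.
have key : `|'[u, frame l v (m, n)]| = `|'[v, frame l u (n, m)]|.
  by rewrite -frame_adjoint dotC norm_conjC.
by congr EFin; congr complex.Re; congr (_ ^+ 2); exact: key.
Qed.

Lemma frame_weight_sum l v : std l v ->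
  (\esum_(t in [set: {classic nu l}]) frame_weight l v (Om t) = 1)%E.
Proof.
move=> sv; have [stdOm ortOm _] := decOm.
have := @parseval_esum R pi ({classic nu l} * (nat * nat))%type
  (fun p => frame l (Om p.1) p.2) v.
rewrite (std_norm sv) expr1n /= => <-.
- rewrite /frame_weight esum_esum; last first.
    by move=> *; rewrite lee_fin -lecR RRe_real ?rpredX ?normr_real // exprn_ge0.
  congr esum; apply/seteqP; split => //.
- move=> [t x] [t' x'] ne /=; have [e|tt'] := pselect (t = t').
    rewrite -e; apply: frame_ortho => // e'.
    by apply: ne; rewrite e e'.
  have cx := @frame_cyc _ _ _ _ s x0 _ l (Om t) x.
  have cx' := @frame_cyc _ _ _ _ s x0 _ l (Om t') x'.
  apply: (ortOm l t l t' _ _ _ cx cx').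
  by move=> e; apply: tt'; exact: existT_inj_snd e.
- by move=> [t x]; exact: frame_norm.
- exact: frame_total.
Qed.

End Coefficients.

Lemma multiplicity_uniq pi nu nu' (Om : forall l, nu l -> pi)
    (Om' : forall l, nu' l -> pi) :
  vector_decomposition Om -> vector_decomposition Om' ->
  forall l, exists f : nu l -> nu' l, bijective f.
Proof.
move=> dec dec' l; have [stdOm _ _] := dec; have [stdOm' _ _] := dec'.
pose a (t : {classic nu l}) (u : {classic nu' l}) : \bar R :=
  frame_weight l (Om l t) (Om' l u).
have col u : (\esum_(t in [set: {classic nu l}]) a t u = 1)%E.
  rewrite -(frame_weight_sum dec (stdOm' l u)).
  by apply: eq_esum => t _; exact: frame_weightC.
have row t : (\esum_(u in [set: {classic nu' l}]) a t u = 1)%E.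
  exact: (frame_weight_sum dec' (stdOm l t)).
have a0 t u : (0 <= a t u)%E by exact: frame_weight_ge0.
have [f [g fK gK]] := doubly_stochastic_bij a0 row col.
by exists f; exists g.
Qed.

End Decompositions.

(** * The dynamics of a permutative basis *)

Lemma prim_root_exists (F : closedFieldType) n : (n%:R != 0 :> F) ->
  exists z : F, n.-primitive_root z.
Proof.
move=> nF; have n0 : (0 < n)%N by rewrite lt0n; apply: contraNneq nF => ->.
pose p : {poly F} := 'X^n - 1; have [r Dp] := closed_field_poly_normal p.
rewrite (monicP _) ?monicXnsubC // scale1r in Dp.
have rn1 : all n.-unity_root r by apply/allP=> z; rewrite -root_prod_XsubC -Dp.
have sz_r : (n < (size r).+1)%N.
  by rewrite -(size_prod_XsubC r id) -Dp size_XnsubC.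
have [|z] := hasP (has_prim_root n0 rn1 _ sz_r); last by exists z.
by rewrite -separable_prod_XsubC -Dp separable_Xn_sub_1.
Qed.

Lemma unit_root (R : realType) (z : R[i]) n : (0 < n)%N -> `|z ^+ n| = 1 -> `|z| = 1.
Proof.
by move=> n0; rewrite normrX => /eqP; rewrite pexpr_eq1 // => /eqP.
Qed.

Section Existence.
Variables (R : realType) (N : nat) (A : 'M[bool]_N).
Variables (O : cstarAlgType R) (s : 'I_N -> O).
Hypothesis hO : is_cuntz_krieger A s.
Variable x0 : 'I_N.
Local Notation raise := (raise s).
Local Notation lower := (lower s).
Local Notation down := (down s).
Local Notation up := (up s).
Local Notation coded := (coded s).
Variables (pi : representation O) (Lambda : Type) (e : Lambda -> pi).

(** Some [lower i] does not kill a given basis vector, which is then, up to a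
    phase, the image under [raise i] of a basis vector; [raise i] being
    isometric there, [lower i] leads back. *)
Lemma basis_dynamics : permutative_basis s e ->
  exists (lab : Lambda -> 'I_N) (pred : Lambda -> Lambda),
    (forall n, raise (lab n) (lower (lab n) (e n)) = e n) /\
    (forall n, exists2 ph : R[i], `|ph| = 1 & lower (lab n) (e n) = ph *: e (pred n)) /\
    (forall i n, raise i (e n) = 0 \/
      exists2 k, pred k = n & exists2 ph : R[i], `|ph| = 1 & raise i (e n) = ph *: e k).
Proof.
move=> [[[e1 eo] etot] [D [z [m Dzm]]]].
have raise_e i n : raise i (e n) = 0 \/ exists k,
    exists2 ph : R[i], `|ph| = 1 & raise i (e n) = ph *: e k.
  have [Din nDin] := Dzm i n; have [/Din[z1 zE]|/nDin] := pselect (D i n); last by left.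
  by right; exists (m i n), (z i n).
have e_inj k k' : '[e k, e k'] <> 0 -> k = k'.
  by move=> h; apply: contrapT => ne; apply: h; exact: eo.
have [f fP] : exists f : Lambda -> 'I_N * Lambda, forall n,
    raise (f n).1 (lower (f n).1 (e n)) = e n /\
    exists2 ph : R[i], `|ph| = 1 & lower (f n).1 (e n) = ph *: e (f n).2.
  suff /choice[f] : forall n, exists y : 'I_N * Lambda,
    raise y.1 (lower y.1 (e n)) = e n /\
    exists2 ph : R[i], `|ph| = 1 & lower y.1 (e n) = ph *: e y.2 by exists f.
  move=> n; have [i li] : exists i, lower i (e n) <> 0.
    apply: contrapT => nli; have := sum_raise_lower hO (e n).
    rewrite big1 => [e0|i _].
      by have /eqP := e1 n; rewrite -e0 normr0 eq_sym oner_eq0.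
    have -> : lower i (e n) = 0 by apply: contrapT => h; apply: nli; exists i.
    exact: raise0.
  have [k ik] : exists k, '[e k, lower i (e n)] <> 0.
    apply: contrapT => h; apply: li; apply: (total_ext etot) => k.
    by rewrite dot0r; apply: contrapT => h'; apply: h; exists k.
  rewrite -dot_raise in ik.
  have [ik0|[k' [ph ph1 rk]]] := raise_e i k; first by case: ik; rewrite ik0 dot0l.
  have kn : k' = n.
    by apply: e_inj => h; apply: ik; rewrite rk dotZl h mulr0.
  rewrite kn in rk; have ph0 := unit_neq0 ph1.
  have en : e n = ph^-1 *: raise i (e k) by rewrite rk scalerK.
  have ln : lower i (e n) = ph^-1 *: e k.
    by rewrite en lowerZ (lower_raise_norm hO) // rk normrZ ph1 mul1r !e1.
  exists (i, k) => /=; rewrite ln raiseZ -en; split=> //.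
  by exists ph^-1 => //; rewrite normfV ph1 invr1.
exists (fun n => (f n).1), (fun n => (f n).2).
split; first by move=> n; have [] := fP n.
split=> [n|i n]; first by have [] := fP n.
have [->|[k [ph ph1 rn]]] := raise_e i n; [by left|right; exists k; last by exists ph].
have ph0 := unit_neq0 ph1.
have [rk [ph' ph1' lk]] := fP k.
have lri : lower i (raise i (e n)) = e n.
  by apply: (lower_raise_norm hO); rewrite rn normrZ ph1 mul1r !e1.
have ek : e k = ph^-1 *: raise i (e n) by rewrite rn scalerK.
have fi : (f k).1 = i.
  apply/eqP; apply: contraT => ne; have := lk.
  rewrite ek lowerZ (lower_raise_neq hO) // scaler0 => /esym/eqP.
  rewrite scaler_eq0 (negbTE (unit_neq0 ph1')) /= => /eqP e0.
  by have /eqP := e1 (f k).2; rewrite e0 normr0 eq_sym oner_eq0.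
apply: e_inj => h; have := congr1 (fun u => '[u, e n]) lk.
rewrite fi ek lowerZ lri dotZl dotZl h mulr0 dotuu e1 expr1n mulr1 => /eqP.
by rewrite invr_eq0 (negbTE ph0).
Qed.

Section Dynamics.
Hypothesis eo : orthonormal_family e.
Variables (lab : Lambda -> 'I_N) (pred : Lambda -> Lambda).
Hypothesis lab_raise : forall n, raise (lab n) (lower (lab n) (e n)) = e n.
Hypothesis lab_lower : forall n,
  exists2 ph : R[i], `|ph| = 1 & lower (lab n) (e n) = ph *: e (pred n).
Hypothesis raise_basis : forall i n, raise i (e n) = 0 \/
  exists2 k, pred k = n & exists2 ph : R[i], `|ph| = 1 & raise i (e n) = ph *: e k.

Definition itinerary n : nat -> 'I_N := fun j => lab (iter j pred n).

Lemma shift_itinerary j n : shift j (itinerary n) = itinerary (iter j pred n).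
Proof. by apply/funext => k; rewrite /shift /itinerary addnC iterD. Qed.

Lemma basis_neq0 n : e n <> 0.
Proof. by move=> h; have /eqP := eo.1 n; rewrite h normr0 eq_sym oner_eq0. Qed.

Lemma basis_down n j : exists2 ph : R[i], `|ph| = 1 &
  down (itinerary n) j (e n) = ph *: e (iter j pred n).
Proof.
elim: j => [|j [ph ph1 IH]]; first by exists 1; rewrite ?normr1 ?scale1r.
have [ph' ph1' h] := lab_lower (iter j pred n).
exists (ph * ph'); first by rewrite normrM ph1 ph1' mulr1.
by rewrite /= IH lowerZ h scalerA.
Qed.

Lemma basis_coded n : coded (itinerary n) (e n).
Proof.
move=> j; have [ph _ /= ->] := basis_down n j.
by rewrite lowerZ raiseZ lab_raise.
Qed.

Lemma down_ortho n j k : iter j pred n <> iter k pred n ->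
  '[down (itinerary n) j (e n), down (itinerary n) k (e n)] = 0.
Proof.
move=> jk; have [ph _ ->] := basis_down n j; have [ph' _ ->] := basis_down n k.
by rewrite dotZl dotZr eo.2 // !mulr0.
Qed.

(** The classes of this relation are the connected components of the graph of
    [pred]. *)
Definition meet n n' : Prop := exists j k, iter j pred n = iter k pred n'.

Lemma meet_sym n n' : meet n n' -> meet n' n.
Proof. by move=> [j [k jk]]; exists k, j. Qed.
Lemma meet_trans n n' n'' : meet n n' -> meet n' n'' -> meet n n''.
Proof.
move=> [j [k jk]] [j' [k' jk']]; exists (j' + j)%N, (k + k')%N.
by rewrite iterD jk -iterD addnC iterD jk' -iterD.
Qed.
Lemma meet_iter n j : meet (iter j pred n) n.
Proof. by exists 0%N, j. Qed.

Lemma cyc_scale (v : pi) a : a != 0 -> cyc (a *: v) = cyc v.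
Proof.
move=> a0; have cl (u : pi) b : cyc u (b *: u).
  by apply: (closed_subspaceZ _ (@cyc_closed _ _ _ u)); exact: cyc_refl.
apply: (cyc_eq hO) => //.
by rewrite -[X in cyc _ X](scalerK a0).
Qed.

Lemma cyc_iter n j : cyc (e (iter j pred n)) = cyc (e n).
Proof.
have [ph ph1 dn] := basis_down n j.
rewrite -(cyc_scale (e (iter j pred n)) (unit_neq0 ph1)) -dn (cyc_down hO) //.
exact: basis_coded.
Qed.

Lemma cyc_meet n n' : meet n n' -> cyc (e n) = cyc (e n').
Proof. by move=> [j [k jk]]; rewrite -(cyc_iter n j) jk cyc_iter. Qed.

(** [lower] follows [pred] and [raise] goes back along it, and neither leaves
    the class of [n]. *)
Lemma meet_reducing n : reducing s (clspan (fun k : {k | meet k n} => e (sval k))).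
Proof.
pose F (k : {k | meet k n}) := e (sval k); have cF := clspan_closed F.
have memF k : meet k n -> clspan F (e k).
  by move=> kn; exact: (@clspan_mem _ _ _ F (exist _ k kn)).
change (reducing s (clspan F)); split=> // i u Fu; split.
  have cR : closed_subspace (raise i @^-1` clspan F).
    apply: preimage_closed_subspace cF; first exact: raise_linear.
    exact: rep_op_continuous.
  apply: (clspan_min cR) Fu => -[k kn] /=; rewrite /F /=.
  have [->|[k' k'k [ph _ ->]]] := raise_basis i k; first by case: cF.
  apply: closed_subspaceZ cF _; apply: memF.
  by apply: meet_trans kn; exists 1%N, 0%N.
have cL : closed_subspace (lower i @^-1` clspan F).
  apply: preimage_closed_subspace cF; first exact: lower_linear.
  exact: rep_op_continuous.
apply: (clspan_min cL) Fu => -[k kn] /=; rewrite /F /=.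
have [->|ne] := eqVneq i (lab k); last first.
  by rewrite (lower_coded_neq hO (basis_coded k)) //; case: cF.
have [ph _ ->] := lab_lower k; apply: closed_subspaceZ cF _; apply: memF.
exact: meet_trans (meet_iter k 1) kn.
Qed.

Lemma cyc_basis_ortho n n' : ~ meet n n' ->
  forall x y, cyc (e n) x -> cyc (e n') y -> '[x, y] = 0.
Proof.
move=> nn' x y.
have mem k : clspan (fun q : {q | meet q k} => e (sval q)) (e k).
  have kk : meet k k by exists 0%N, 0%N.
  pose g (q : {q | meet q k}) := e (sval q).
  exact: (@clspan_mem _ _ _ g (exist (fun q => meet q k) k kk)).
move=> /(cyc_min hO (meet_reducing n) (mem n)) cx.
move=> /(cyc_min hO (meet_reducing n') (mem n')) cy.
apply: clspan_ortho2 cx cy => -[k kn] [k' kn'] /=; apply: eo.2 => kk'.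
by apply: nn'; apply: meet_trans (meet_sym kn) _; rewrite kk'.
Qed.

End Dynamics.

(** * Eigenvectors along a cycle *)

(** The operator [down K q] permutes the vectors [down K (j * q) v] cyclically,
    up to the factor [g]; its eigenvectors are their discrete Fourier
    components, with eigenvalues the [m]-th roots of [g]. *)
Lemma cycle_eigenvectors (K : nat -> 'I_N) q m (v : pi) (g : R[i]) :
  shift q K = K -> coded K v -> (0 < m)%N -> `|g| = 1 ->
  down K (m * q) v = g *: v ->
  exists (lam : nat -> R[i]) (w : nat -> pi),
    [/\ forall k, `|lam k| = 1,
        forall k, [/\ coded K (w k), down K q (w k) = lam k *: w k & cyc v (w k)],
        forall k k', (k < m)%N -> (k' < m)%N -> k <> k' -> lam k <> lam k'
      & \sum_(k < m) w k = m%:R *: v].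
Proof.
move=> qK cv m0 g1 dm.
have [|om pom] := @prim_root_exists R[i] m; first by rewrite pnatr_eq0 -lt0n.
pose ze := m.-root g; have zeE : ze ^+ m = g by rewrite rootCK.
have ze1 : `|ze| = 1 by apply: (unit_root m0); rewrite zeE.
have om1 : `|om| = 1.
  by apply: (unit_root m0); rewrite (prim_expr_order pom) normr1.
(* The [m]-th roots of [g]. *)
pose lam k := ze * om ^+ k.
have lam1 k : `|lam k| = 1 by rewrite normrM normrX ze1 om1 expr1n mulr1.
have lam0 k : lam k != 0 := unit_neq0 (lam1 k).
have lamm k : lam k ^+ m = g.
  by rewrite exprMn zeE exprAC (prim_expr_order pom) expr1n mulr1.
pose x j := down K (j * q) v.
have xS j : down K q (x j) = x j.+1.
  by rewrite /x mulSn addnC down_add (period_iter j qK).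
have cx j : coded K (x j).
  by have := coded_down (j * q) cv; rewrite (period_iter j qK).
pose w k := \sum_(j < m) (lam k)^-1 ^+ j *: x j.
exists lam, w; split=> //.
- move=> k; split.
  + by apply: coded_sum => j; exact: codedZ.
  + rewrite /w (linear_S (down_linear _ _ _)) scaler_sumr.
    transitivity (\sum_(j < m) lam k *: ((lam k)^-1 ^+ j.+1 *: x j.+1)).
      apply: eq_bigr => j _; rewrite downZ xS scalerA exprS mulrA divff ?mul1r //.
    rewrite -!scaler_sumr; congr (_ *: _).
    pose F j := (lam k)^-1 ^+ j *: x j.
    have Fm : F m = F 0%N.
      rewrite /F /x dm mul0n expr0 scale1r scalerA exprVn lamm mulVf ?scale1r //.
      exact: unit_neq0.
    have : F 0%N + \sum_(j < m) F j.+1 = \sum_(j < m) F j + F m.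
      transitivity (\sum_(j < m.+1) F j); first by rewrite big_ord_recl.
      by rewrite big_ord_recr.
    by rewrite Fm addrC => /addIr.
  + have cV := @cyc_closed _ _ _ v.
    apply: (closed_subspace_sum _ cV) => j; apply: (closed_subspaceZ _ cV).
    rewrite /x; elim: (j * q)%N => [|i IH]; [exact: cyc_refl|exact: cyc_op].
- move=> k k' km k'm kk' /(mulfI (unit_neq0 ze1)) /eqP.
  by rewrite (eq_prim_root_expr pom) !modn_small // => /eqP.
- rewrite /w exchange_big /= (bigD1 (Ordinal m0)) //= [X in _ + X]big1 ?addr0.
    under eq_bigr do rewrite expr0 scale1r.
    by rewrite sumr_const card_ord /x mul0n scaler_nat.
  move=> j j0; rewrite -scaler_suml.
  have -> : \sum_(k < m) (lam k)^-1 ^+ j = 0; last by rewrite scale0r.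
  have {}j0 : (0 < j)%N by rewrite lt0n; apply: contra j0 => /eqP j0; apply/eqP/val_inj.
  pose eta := om^-1 ^+ j.
  transitivity (ze^-1 ^+ j * \sum_(k < m) eta ^+ k).
    rewrite mulr_sumr; apply: eq_bigr => k _.
    by rewrite /lam invfM exprMn -exprVn exprAC.
  have etam : eta ^+ m = 1.
    by rewrite /eta exprAC exprVn (prim_expr_order pom) invr1 expr1n.
  have := subrX1 eta m; rewrite etam subrr => /esym/eqP; rewrite mulf_eq0 subr_eq0.
  case/orP=> /eqP h; last by rewrite h mulr0.
  have : om ^+ j == 1 by rewrite -[om]invrK exprVn -/eta h invr1.
  rewrite -(prim_order_dvd pom) => /(dvdn_leq j0).
  by rewrite leqNgt ltn_ord.
Qed.

End Existence.

(** * Existence of the decomposition *)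

Section Components.
Variables (R : realType) (N : nat) (A : 'M[bool]_N).
Variables (O : cstarAlgType R) (s : 'I_N -> O).
Hypothesis hO : is_cuntz_krieger A s.
Variable x0 : 'I_N.
Variables (pi : representation O) (Lambda : Type) (e : Lambda -> pi).
Hypothesis eo : orthonormal_family e.
Hypothesis etot : clspan e = [set: pi].
Variables (lab : Lambda -> 'I_N) (pred : Lambda -> Lambda).
Hypothesis lab_raise : forall n, raise s (lab n) (lower s (lab n) (e n)) = e n.
Hypothesis lab_lower : forall n,
  exists2 ph : R[i], `|ph| = 1 & lower s (lab n) (e n) = ph *: e (pred n).
Hypothesis raise_basis : forall i n, raise s i (e n) = 0 \/
  exists2 k, pred k = n & exists2 ph : R[i], `|ph| = 1 & raise s i (e n) = ph *: e k.
Local Notation itinerary := (itinerary lab pred).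
Local Notation std := (@std R N A O s x0 pi).

Let itinerary_coded n : coded s (itinerary n) (e n) :=
  basis_coded lab_raise lab_lower n.
Let itinerary_admissible n : admissible_sequence A (itinerary n) :=
  coded_admissible hO (itinerary_coded n) (basis_neq0 eo (n := n)).

Lemma aperiodic_std n : (forall j k, j <> k -> iter j pred n <> iter k pred n) ->
  tail_std s (itinerary n) (e n).
Proof.
move=> aper; split; [exact: eo.1|exact: itinerary_coded|move=> j k jk].
by apply: (down_ortho eo lab_lower); exact: aper.
Qed.

Lemma periodic_itinerary n p : iter p pred n = n -> shift p (itinerary n) = itinerary n.
Proof. by move=> pn; rewrite shift_itinerary pn. Qed.

Lemma periodic_down n p : iter p pred n = n ->
  exists2 ph : R[i], `|ph| = 1 & down s (itinerary n) p (e n) = ph *: e n.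
Proof.
by move=> pn; have [ph ph1 h] := basis_down lab_lower n p; exists ph; rewrite // h pn.
Qed.

Lemma orbit_cases n :
  (forall j k, j <> k -> iter j pred n <> iter k pred n) \/
  exists j p, (0 < p)%N /\ iter p pred (iter j pred n) = iter j pred n.
Proof.
have [h|/existsNP[j /existsNP[k /not_implyP[jk /contrapT h]]]] := pselect (forall j k,
    j <> k -> iter j pred n <> iter k pred n); [by left|right].
wlog lt_jk : j k jk h / (j < k)%N => [wl|].
  have [lt|lt|//] := ltngtP j k; first exact: (wl j k).
  exact: (wl k j (nesym jk) (esym h)).
by exists j, (k - j)%N; rewrite subn_gt0 -iterD subnK ?(ltnW lt_jk) // lt_jk.
Qed.

(** An aperiodic orbit gives a single piece; for an orbit that ends in a cycle
    the pieces are the nonzero Fourier components of a vector of the cycle whose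
    code repeats a minimal word. The pieces are indexed by the numbers
    satisfying [good]. *)
Lemma component_split n : exists (good : nat -> Prop) (lb : nat -> label R A)
    (v : nat -> pi),
  [/\ forall i, good i -> std (lb i) (v i) /\ cyc (e n) (v i),
      forall i j, good i -> good j -> i <> j -> lb i <> lb j
    & forall M : set pi, reducing s M -> (forall i, good i -> M (v i)) -> M (e n)].
Proof.
have [aper|[j [p [p0 pj]]]] := orbit_cases n.
  have admK := itinerary_admissible n.
  have [k kn] : exists k : tail_label A, sval k (itinerary n).
    exists (exist _ (tail_class A (itinerary n))
      (ex_intro2 _ _ (itinerary n) admK erefl)).
    exact: tail_class_mem.
  have [admL kE] := tail_code R x0 k; move: kn.
  rewrite kE => -[_ /tail_equivalentP[a [b ab]]].
  have [v sv cycv] := tail_std_transport hO admL (esym ab) (aperiodic_std aper).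
  exists (fun i => i = 0%N), (fun=> inr k), (fun=> v); split.
  - by move=> i _; split=> //; rewrite -cycv; exact: cyc_refl.
  - by move=> i i' -> ->.
  - move=> M rM Mv; have := cyc_min hO rM (Mv 0%N erefl); rewrite cycv; apply.
    exact: cyc_refl.
set n1 := iter j pred n in pj.
have [r [J [J0 mJ nJ rJ]]] := exists_cycle_word x0 p0 (periodic_itinerary pj).
pose n2 := iter r pred n1.
have n2p : iter p pred n2 = n2 by rewrite -iterD addnC iterD pj.
have KE : itinerary n2 = repeat_word x0 J by rewrite -shift_itinerary.
set K := itinerary n2 in KE.
have cyc2 : cyc (e n2) = cyc (e n).
  by rewrite !(cyc_iter hO lab_raise lab_lower).
have qK : shift (size J) K = K by rewrite KE; exact: repeat_word_period.
have q0 : (0 < size J)%N by rewrite lt0n size_eq0.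
have admJ : admissible_cycle A J.
  rewrite -(mkseq_repeat_word x0 J) -KE; apply: admissible_mkseq => //.
  exact: itinerary_admissible.
have n2pq : iter (p * size J) pred n2 = n2.
  by elim: (size J) => [|q IH]; rewrite ?muln0 // mulnS iterD IH.
have [g g1 dg] := periodic_down n2pq.
have [lam [w [lam1 wP lam_inj sumw]]] :=
  cycle_eigenvectors qK (itinerary_coded n2) p0 g1 dg.
pose Jl : cycle_label A := exist _ J (And3 admJ mJ nJ).
have lamV k : `|(lam k)^-1| == 1 by rewrite normfV lam1 invr1.
pose lb k : label R A := inl (Jl, exist _ (lam k)^-1 (lamV k)).
exists (fun k => (k < p)%N /\ w k <> 0), lb, (fun k => `|w k|^-1 *: w k); split.
- move=> k [kp wk0]; have [cw dw cycw] := wP k.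
  have nw : `|w k| != 0 by rewrite normr_eq0; exact/eqP.
  split; last by rewrite -cyc2; apply: (closed_subspaceZ _ (@cyc_closed _ _ _ _)).
  split; rewrite /= -?KE.
  + by rewrite normrZ normfV normr_id mulVf.
  + exact: codedZ.
  + by rewrite downZ dw invrK !scalerA mulrC.
- move=> k k' [kp _] [k'p _] kk' [] /invr_inj; exact: lam_inj.
- move=> M rM Mw; have [cM _] := rM.
  have {}Mw k : (k < p)%N -> M (w k).
    move=> kp; have [->|wk0] := eqVneq (w k) 0; first by case: cM.
    have nw : `|w k| != 0 by rewrite normr_eq0.
    rewrite -[w k](scalerKV nw); apply: (closed_subspaceZ _ cM); apply: Mw.
    by split=> //; exact/eqP.
  have M2 : M (e n2).
    have pR : p%:R != 0 :> R[i] by rewrite pnatr_eq0 -lt0n.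
    rewrite -[e n2](scalerK pR) -sumw; apply: (closed_subspaceZ _ cM).
    by apply: (closed_subspace_sum _ cM) => k; exact: Mw.
  have := cyc_min hO rM M2; rewrite cyc2; apply; exact: cyc_refl.
Qed.

(** One vector is chosen in each component, as the value of [root] on it, and
    split into its pieces. *)
Lemma exists_vector_decomposition :
  exists (nu : label R A -> Type) (Om : forall l, nu l -> pi),
    vector_decomposition s x0 Om.
Proof.
have /choice[good] := component_split.
move=> /choice[lb] /choice[v comp].
pose pick (C : set Lambda) (h : exists n, C n) := sval (cid h).
have pickP C h : C (@pick C h) by exact: (svalP (cid h)).
have pick_eq C C' h h' : C = C' -> @pick C h = @pick C' h'.
  by move=> e'; case: _ / e' in h' *; rewrite (Prop_irrelevance h h').
have meet_refl n : meet pred n n by exists 0%N, 0%N.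
pose cls n k := meet pred k n.
pose root n := @pick (cls n) (ex_intro (cls n) n (meet_refl n)).
have rootP n : meet pred (root n) n := pickP (cls n) _.
have root_eq n n' : meet pred n n' -> root n = root n'.
  move=> nn'; apply: pick_eq; apply/funext => k; apply/propext; split=> h.
    exact: meet_trans nn'.
  exact: meet_trans (meet_sym nn').
have root_root n : root (root n) = root n by exact: root_eq.
pose nu l := {p : Lambda * nat | [/\ root p.1 = p.1, good p.1 p.2 & lb p.1 p.2 = l]}.
exists nu, (fun l t => v (sval t).1 (sval t).2); split.
- move=> l [[n i] [/= _ gi <-]]; have [h _ _] := comp n.
  by case: (h i gi).
- move=> l [[n i] pt] l' [[n' i'] pt'] /= ne; have [/= rn gi li] := pt.
  have [/= rn' gi' li'] := pt'.
  have [h hl _] := comp n; have [h' _ _] := comp n'.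
  have [svi cvi] := h i gi; have [svi' cvi'] := h' i' gi'.
  have [nn'|nn'] := pselect (n = n'); last first.
    move=> x y /(cyc_sub hO cvi) cx /(cyc_sub hO cvi') cy.
    apply: (cyc_basis_ortho hO eo lab_raise lab_lower raise_basis _ cx cy).
    by move=> /root_eq; rewrite rn rn'.
  have [ii'|ii'] := pselect (i = i').
    exfalso; apply: ne; move: pt pt'; rewrite -nn' -ii' -li -li' -nn' -ii' => pt pt'.
    by rewrite (Prop_irrelevance pt pt').
  apply: (std_disjoint hO svi svi'); rewrite -nn' in gi' *; exact: hl.
- move=> z oz; apply: (total_ext etot) => n; rewrite dot0r.
  pose M : set pi := [set y | forall x, '[rep_op x y, z] = 0].
  have rM : reducing s M.
    split; last by move=> i y My; split=> x; rewrite /raise /lower -rep_opM.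
    apply: (@closed_subspaceI _ _ O (fun x => [set y | '[rep_op x y, z] = 0])) => x.
    have cx := @rep_op_continuous _ _ pi x.
    have lx := @rep_op_linear _ _ pi x.
    exact: (preimage_closed_subspace lx cx (orthocomplement_closed z)).
  have [_ _ h] := comp (root n).
  have Mr : M (e (root n)).
    apply: h => // i gi x.
    pose t : nu (lb (root n) i) := exist _ (root n, i) (And3 (root_root n) gi erefl).
    by apply: (oz _ t); apply: cyc_op; exact: cyc_refl.
  have : M (e n).
    apply: (cyc_min hO rM Mr).
    by rewrite (cyc_meet hO lab_raise lab_lower (rootP n)); exact: cyc_refl.
  by move=> /(_ 1); rewrite rep_op1.
Qed.

End Components.

Theorem proposition5p9 (R : realType) (N : nat) (A : 'M[bool]_N)
    (O : cstarAlgType R) (s : 'I_N -> O) (pi : representation O)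
    (hN : (2 <= N)%N) (hA : nondegenerate_mx A)
    (hO : is_cuntz_krieger A s) (hpi : permutative s pi) :
  (exists (nu : label R A -> Type)
          (rho : forall l, nu l -> representation O),
     decomposition s pi rho /\
     (forall (nu' : label R A -> Type)
             (rho' : forall l, nu' l -> representation O),
        decomposition s pi rho' ->
        forall l, exists f : nu l -> nu' l,
          bijective f /\
          (forall t, unitarily_equivalent (rho l t) (rho' l (f t))))) /\
  (cyclic_permutative s pi ->
     (exists (J : seq 'I_N) (c : R[i]),
        [/\ admissible_cycle A J, `|c| = 1
          & exists2 rho : representation O,
              is_P_cycle s rho J c & unitarily_equivalent pi rho]) \/
     (exists K : nat -> 'I_N,
        admissible_sequence A K /\
        exists2 rho : representation O,
          is_P_sequence s rho K & unitarily_equivalent pi rho)).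
Proof.
pose x0 : 'I_N := Ordinal (ltnW hN).
split.
  have [Lambda [e basis_e]] := hpi.
  have [lab [pred [lab_raise [lab_lower raise_basis]]]] := basis_dynamics hO basis_e.
  have [[eo etot] _] := basis_e.
  have [nu [Om dec]] :=
    exists_vector_decomposition hO x0 eo etot lab_raise lab_lower raise_basis.
  exists nu, (fun l t => cyc_rep (Om l t)).
  have decP := vector_decomposition_rep hO dec; split=> // nu' rho' dec' l.
  have [Om' vdec'] := decomposition_vector hO x0 dec'.
  have [f fb] := multiplicity_uniq hO dec vdec' l.
  exists f; split=> // t.
  have [v sv vcyc] := in_class_std hO x0 (decP.1 l t).
  have [v' sv' vcyc'] := in_class_std hO x0 (dec'.1 l (f t)).
  exact: (std_equivalent hO sv sv' vcyc vcyc').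
move=> [Lambda [e [basis_e [n ncyc]]]].
have [lab [pred [lab_raise [lab_lower raise_basis]]]] := basis_dynamics hO basis_e.
have [[eo _] _] := basis_e.
have self : unitarily_equivalent pi pi by exists idfun; split=> //; exists idfun.
have cycn j : cyclic_vector (e (iter j pred n)).
  by rewrite /cyclic_vector -/(cyc _) (cyc_iter hO lab_raise lab_lower).
have admK k : admissible_sequence A (itinerary lab pred k).
  apply: (coded_admissible hO (basis_coded lab_raise lab_lower k)).
  exact: (basis_neq0 eo (n := k)).
have [aper|[j [p0 [p0_gt0 p0n]]]] := orbit_cases pred n.
  right; exists (itinerary lab pred n); split; first exact: admK.
  exists pi => //; apply: (std_P_sequence _ ncyc).
  exact: (aperiodic_std eo lab_raise lab_lower aper).
left; set n1 := iter j pred n in p0n.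
(* The word is read along one turn of the cycle of basis vectors; it may be
   periodic, when several vectors of the cycle have the same code. *)
have : exists p, `[< (0 < p)%N /\ iter p pred n1 = n1 >].
  by exists p0; apply/asboolP.
move=> /ex_minnP[p /asboolP[p_gt0 pn] p_min].
have inj a b : (a < b)%N -> (b < p)%N -> iter a pred n1 <> iter b pred n1.
  move=> ab bp abn; have := p_min (a + (p - b))%N.
  have -> : `[< (0 < a + (p - b))%N /\ iter (a + (p - b)) pred n1 = n1 >] = true.
    apply/asboolP; split; first by rewrite addn_gt0 subn_gt0 bp orbT.
    by rewrite addnC iterD abn -iterD subnK ?(ltnW bp).
  by move=> /(_ isT); lia.
have [g g1 dg] := periodic_down lab_lower pn.
pose K := itinerary lab pred n1.
have pK : shift p K = K by exact: periodic_itinerary.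
exists (mkseq K p), g^-1; split.
- by apply: (admissible_mkseq (Ordinal (ltnW hN)) p_gt0 pK); exact: admK.
- by rewrite normfV g1 invr1.
- exists pi => //; apply: (std_P_cycle p_gt0 pK _ _ _ (cycn j)).
  + by rewrite normfV g1 invr1.
  + move=> a b ap bp ab; apply: (down_ortho eo lab_lower).
    have [lt|lt|//] := ltngtP a b; first exact: inj.
    by move=> /esym; exact: inj.
  + split; [exact: eo.1|exact: basis_coded|by rewrite invrK].
Qed.
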